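(* Every ribbon $1$-knot is half ribbon.
   Context: All manifolds and embeddings are smooth and orientable. A $1$-knot is a knot in $S^3$. A ribbon surface for a $1$-knot $K$ is a compact orientable surface $F$ properly embedded in $B^4$ with $\partial F = K$ on which the radial height function restricts to a Morse function without critical points of index $2$. A $1$-knot is ribbon if it bounds a ribbon surface of genus $0$ (a ribbon disc). A $2$-knot is an embedding $S^2\hookrightarrow S^4$, up to ambient isotopy; it is ribbon if it bounds a properly embedded handlebody (a $3$-ball) in $B^5$ on which the radial height function restricts to a Morse function without critical points of index $2$. (Equivalently, it is isotopic to a surface obtained by attaching $3$-dimensional $1$-handles to a disjoint union of standard $2$-spheres in $S^4$, where an embedded $2$-sphere is standard if it is in Morse position with exactly two critical points.) A $1$-knot $K$ divides a $2$-knot $S$ if there is an equator $S^3_0 \subset S^4$ with $S^3_0 \cap S = K$. A $1$-knot is half ribbon if it divides a ribbon $2$-knot. *)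

(* Defs.v *)
From HB Require Import structures.
From mathcomp Require Import all_boot all_order all_algebra.
From mathcomp Require Import all_classical all_reals all_analysis.
Import Order.TTheory GRing.Theory Num.Theory.
Import numFieldNormedType.Exports.
Set Implicit Arguments.
Unset Strict Implicit.
Unset Printing Implicit Defensive.
Local Open Scope classical_set_scope.
Local Open Scope ring_scope.

Fixpoint Ck (R : realType) (V W : normedModType R) (k : nat)
    (U : set V) (f : V -> W) : Prop :=
  match k with
  | 0 => forall x, U x -> {for x, continuous f}
  | k'.+1 => (forall x, U x -> differentiable f x) /\
             (forall v, Ck k' U ('D_v f))
  end.

(* A smooth map on a subset A is, as usual, the restriction of a smooth map
   defined on an open neighbourhood of A; f itself is taken to be such an
   extension, and its values away from that neighbourhood are irrelevant. *)
Definition smooth_on (R : realType) (V W : normedModType R)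
    (A : set V) (f : V -> W) : Prop :=
  exists U : set V, [/\ open U, A `<=` U & forall k, Ck k U f].

Section Euclidean.
Context {R : realType}.

Definition dotp n (x y : 'rV[R]_n) : R := \sum_i x 0 i * y 0 i.

(* The library norm on 'rV[R]_n is the sup norm; this is the Euclidean norm,
   that is, the radial height function. *)
Definition radius n (x : 'rV[R]_n) : R := Num.sqrt (dotp x x).

Definition uball n : set 'rV[R]_n := [set x | radius x <= 1].

(* The unit sphere of R^n, of dimension n - 1. *)
Definition usphere n : set 'rV[R]_n := [set x | radius x = 1].

(* Injective immersions; the domains are compact, so these are embeddings. *)
Definition ball_embedding k n (f : 'rV[R]_k -> 'rV[R]_n) : Prop :=
  [/\ smooth_on (@uball k) f,
      {in @uball k &, injective f} &
      forall x v, uball x -> 'D_v f x = 0 -> v = 0].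

(* The tangent space of the sphere at x is the orthogonal complement of x. *)
Definition sphere_embedding k n (f : 'rV[R]_k -> 'rV[R]_n) : Prop :=
  [/\ smooth_on (@usphere k) f,
      {in @usphere k &, injective f} &
      forall x v, usphere x -> dotp x v = 0 -> 'D_v f x = 0 -> v = 0].

(* The last clause is transversality to the boundary sphere: some tangent
   vector of the image at f x is not tangent to the sphere. *)
Definition proper_ball_embedding k n (f : 'rV[R]_k -> 'rV[R]_n) : Prop :=
  [/\ ball_embedding f,
      forall x, uball x -> uball (f x),
      forall x, uball x -> (usphere (f x) <-> usphere x) &
      forall x, usphere x -> exists v, dotp ('D_v f x) (f x) != 0].

Definition critical_point k (h : 'rV[R]_k -> R) (x : 'rV[R]_k) : Prop :=
  forall v, 'D_v h x = 0.

Definition hessian k (h : 'rV[R]_k -> R) (x : 'rV[R]_k) : 'M[R]_k :=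
  \matrix_(i, j) 'D_(delta_mx 0 i) ('D_(delta_mx 0 j) h) x.

(* Subspaces of R^k are given as row spaces. *)
Definition negative_definite_on k (H W : 'M[R]_k) : Prop :=
  forall v : 'rV[R]_k, (v <= W)%MS -> v != 0 -> (v *m H *m v^T) 0 0 < 0.

(* d is the largest dimension of a subspace on which H is negative definite. *)
Definition has_index k (H : 'M[R]_k) (d : nat) : Prop :=
  (exists W : 'M[R]_k, \rank W = d /\ negative_definite_on H W) /\
  (forall W : 'M[R]_k, negative_definite_on H W -> (\rank W <= d)%N).

Definition morse_on k (A : set 'rV[R]_k) (h : 'rV[R]_k -> R) : Prop :=
  smooth_on A h /\
  forall x, A x -> critical_point h x -> hessian h x \in unitmx.

(* The radial height function on the image of f is read off in the
   parametrization f. It has no critical points on the boundary, by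
   transversality. *)
Definition ribbon_ball k n (f : 'rV[R]_k -> 'rV[R]_n) : Prop :=
  [/\ proper_ball_embedding f,
      morse_on (@uball k) (fun x => radius (f x)) &
      forall x, uball x -> critical_point (fun y => radius (f y)) x ->
        ~ has_index (hessian (fun y => radius (f y)) x) 2].

Definition bounds_ribbon_ball k n (A : set 'rV[R]_n) : Prop :=
  exists f : 'rV[R]_k -> 'rV[R]_n, ribbon_ball f /\ f @` @usphere k = A.

(* A k-dimensional knotted sphere in S^(k+2). *)
Definition knot k (A : set 'rV[R]_k.+3) : Prop :=
  A `<=` @usphere k.+3 /\
  exists f : 'rV[R]_k.+1 -> 'rV[R]_k.+3,
    sphere_embedding f /\ f @` @usphere k.+1 = A.

(* For each time t in [0, 1], H t is an embedding of the sphere onto itself,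
   hence a diffeomorphism of it. *)
Definition ambient_isotopic n (A B : set 'rV[R]_n) : Prop :=
  exists H : R -> 'rV[R]_n -> 'rV[R]_n,
    [/\ smooth_on (([set t : R | 0 <= t <= 1] : set R) `*` @usphere n)
          (fun p : R * 'rV[R]_n => H p.1 p.2),
        forall t, 0 <= t <= 1 ->
          sphere_embedding (H t) /\ H t @` @usphere n = @usphere n,
        forall x, usphere x -> H 0 x = x &
        H 1 @` A = B].

(* Genus 0 with boundary a knot: the surface is a disc. *)
Definition ribbon_1knot (K : set 'rV[R]_4) : Prop :=
  knot K /\ bounds_ribbon_ball 2 K.

(* 2-knots are taken up to ambient isotopy, so both notions below are notions
   about isotopy classes. *)
Definition ribbon_2knot (S : set 'rV[R]_5) : Prop :=
  knot S /\
  exists2 S', ambient_isotopic S S' & bounds_ribbon_ball 3 S'.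

(* An equator of S^4 is a great 3-sphere. It is the image of S^3 under a linear
   isometric embedding x |-> x *m L, by means of which K is viewed as a knot in
   the equator. Moving the 2-knot by an isotopy amounts to moving the equator by
   the inverse one. The intersection is transverse, that is, S' has a tangent
   vector outside the hyperplane of the equator at each common point. Were
   tangencies allowed, every slice knot would divide the trivial 2-knot (the
   boundary of a thickened slice disc, touching the equator along the knot). *)
Definition divides (K : set 'rV[R]_4) (S : set 'rV[R]_5) : Prop :=
  exists2 S', ambient_isotopic S S' &
  exists (L : 'M[R]_(4, 5)) (f : 'rV[R]_3 -> 'rV[R]_5),
    [/\ L *m L^T = 1%:M,
        (mulmxr L @` @usphere 4) `&` S' = mulmxr L @` K,
        sphere_embedding f /\ f @` @usphere 3 = S' &
        forall x, usphere x -> (mulmxr L @` @usphere 4) (f x) ->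
          exists2 v, dotp x v = 0 & ~~ ('D_v f x <= L)%MS].

Definition half_ribbon (K : set 'rV[R]_4) : Prop :=
  knot K /\ exists2 S : set 'rV[R]_5, ribbon_2knot S & divides K S.

End Euclidean.

(* Main.v *)
From Pilot Require Import Defs.
From HB Require Import structures.
From mathcomp Require Import all_boot all_order all_algebra.
From mathcomp Require Import all_classical all_reals all_analysis.
From mathcomp Require Import ring lra.
Import Order.TTheory GRing.Theory Num.Theory.
Import numFieldNormedType.Exports.
Local Open Scope classical_set_scope.
Local Open Scope ring_scope.

(** Why the theorem is true.  A ribbon disc D in B^4 has a double: gluing two
copies of (B^4, D) along their boundary gives a 2-sphere S in S^4 which the
equator cuts along the knot, and S bounds the thickened disc D x I in
B^4 x I = B^5, whose radial function has the critical points of D with the same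
indices.  Instead of rounding the corners of B^4 x I, the thickening is taken
directly inside the round ball.  If f parametrizes D, consider
[[
     { (f x, z) : |f x|^2 + z^2 <= 1 }.
]]
Its boundary is the double of D, it meets the hyperplane z = 0 in D, and the
squared radius is |f x|^2 + z^2: the critical points have z = 0 and x critical
for |f|, and the new direction z is positive for the Hessian, so no index
changes and no critical point of index 2 appears.

What remains is a smooth parametrization of this set by the unit ball.  Since
the disc is properly embedded, 1 - |f x|^2 and 1 - |x|^2 both vanish exactly on
the unit circle, to first order, so there is a smooth function q > 0 with
[[
     1 - |f x|^2 = (1 - |x|^2) q x.
]]
Then (x, t) |-> (f x, t * sqrt (q x)) has squared radius
1 - q x * (1 - |x|^2 - t^2), and hence maps the unit ball onto the thickening
and the unit sphere into the unit sphere.  This map is called doubled; doubled_proper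
and doubled_ribbon establish its properties for arbitrary dimensions, and
equator_doubled and doubled_equator_transverse describe how it meets the
equator.  Two facts about f enter separately.  It does not pass through the
origin, where the radius of an immersion is not differentiable
(ball_embedding_neq0); this keeps the radius of the thickening smooth.  And
transversality to the boundary sphere makes q nonzero there (quotient_gt0).

The smooth quotient q is the analytic heart (sphere_division).  Away from the
unit sphere it is a quotient of smooth functions; near the sphere the
fundamental theorem of calculus along the segment from x / |x| to x exhibits it
as an integral over [0, 1] depending on x, and Ck_integral01 shows that such an
integral is as smooth as its integrand. *)

Set Implicit Arguments.
Unset Strict Implicit.
Unset Printing Implicit Defensive.

(* The unqualified name is taken by another constant. *)
Local Notation radius := Pilot.Defs.radius.

(** * Calculus of C^k maps *)

Section Differentiability.
Context {R : realType} {V W : normedModType R}.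
Implicit Types (f g : V -> W) (x : V).

Lemma differentiable_by_estimate f x (L : {linear V -> W}) : continuous L ->
    (forall e : R, 0 < e ->
      \forall h \near (0 : V), `|f (h + x) - f x - L h| <= e * `|h|) ->
  differentiable f x /\ 'd f x = L :> (V -> W).
Proof.
move=> cL fL.
have fxL : f \o shift x = cst (f x) + L +o_ 0 id.
  apply/eqaddoP => e e0; have := fL e e0; apply: filterS => h /=.
  by rewrite opprD addrA.
have dE : 'd f x = L :> (V -> W) by exact: diff_unique.
by split => //; apply/diff_locallyP; rewrite dE.
Qed.

Lemma near_eq_differentiable f g x : (\near x, f x = g x) ->
  differentiable f x -> differentiable g x.
Proof.
move=> fg df.
have cdf : continuous ('d f x) by exact: diff_continuous.
suff [] : differentiable g x /\ 'd g x = 'd f x :> (V -> W) by [].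
apply: differentiable_by_estimate => //.
move=> e e0; have /diff_locallyP[_ /eqaddoP/(_ _ e0)] := df.
have fg0 : \forall h \near (0 : V), f (h + x) = g (h + x).
  have := fg; rewrite (near_shift 0); apply: filterS => h /=.
  by rewrite subr0.
rewrite -(nbhs_singleton fg); apply: filterS2 fg0 => h /= <-.
by rewrite opprD addrA.
Qed.

End Differentiability.

Section CkBasics.
Context {R : realType} {V W : normedModType R}.
Implicit Types (f g : V -> W) (U : set V).

Lemma Ck_continuous k U f x : Ck k U f -> U x -> {for x, continuous f}.
Proof.
case: k => [|k] /=; first exact.
by move=> [df _] Ux; apply: differentiable_continuous; exact: df.
Qed.

Lemma CkW k U f : Ck k.+1 U f -> Ck k U f.
Proof.
elim: k f => [|k IH] f Cf; first by move=> x; exact: Ck_continuous Cf.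
by case: Cf => df Cf; split => // v; apply: IH; exact: Cf.
Qed.

Lemma Ck_subset k U U' f : U' `<=` U -> Ck k U f -> Ck k U' f.
Proof.
move=> U'U; elim: k f => [|k IH] f /=; first by move=> cf x /U'U/cf.
by case=> df Cf; split => [x /U'U/df//|v]; exact: IH.
Qed.

Lemma Ck_setU k U U' f : Ck k U f -> Ck k U' f -> Ck k (U `|` U') f.
Proof.
elim: k f => [|k IH] f /=; first by move=> cf cf' x [/cf|/cf'].
move=> [df Cf] [df' Cf']; split => [x [/df//|/df'//]|v]; exact: IH.
Qed.

(** Being C^k is a local property: over an open set, changing a map elsewhere
does not affect its derivatives. This is what allows computed formulas for
derivatives to replace the derivatives themselves in the inductions below. *)
Lemma eq_Ck k U f g : open U -> (forall x, U x -> f x = g x) ->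
  Ck k U f -> Ck k U g.
Proof.
move=> oU.
have nU x h h' : U x -> (forall x, U x -> h x = h' x :> W) -> \near x, h x = h' x.
  move=> Ux E; have : nbhs x U by exact: open_nbhs_nbhs.
  by apply: filterS => y /E.
elim: k f g => [|k IH] f g fg /=.
  move=> cf x Ux; rewrite /prop_for /continuous_at -(fg x)//.
  apply: cvg_trans (cf x Ux); apply: near_eq_cvg.
  by have := nU x f g Ux fg; apply: filterS => y /= ->.
move=> [df Cf]; split => [x Ux|v].
  by apply: near_eq_differentiable (df x Ux); exact: nU.
by apply: IH (Cf v) => x Ux; apply: near_eq_derive; exact: nU.
Qed.

Lemma Ck_cst k U (a : W) : Ck k U (cst a).
Proof.
elim: k a => [|k IH] a /=; first by move=> x _; exact: cst_continuous.
split => [x _|v]; first exact: differentiable_cst.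
suff -> : 'D_v (cst a) = cst (0 : W) :> (V -> W) by exact: IH.
by apply/funext => x; rewrite derive_cst.
Qed.

Lemma Ck_linear k U (L : {linear V -> W}) : continuous L -> Ck k U L.
Proof.
move=> cL; case: k => [|k] /=; first by move=> x _; exact: cL.
split => [x _|v]; first exact: linear_differentiable.
suff -> : 'D_v L = cst (L v) :> (V -> W) by exact: Ck_cst.
by apply/funext => x; rewrite deriveE ?diff_lin//; exact: linear_differentiable.
Qed.

Lemma CkD k U f g : open U -> Ck k U f -> Ck k U g -> Ck k U (f \+ g).
Proof.
move=> oU; elim: k f g => [|k IH] f g /=.
  by move=> cf cg x Ux; apply: continuousD; [exact: cf|exact: cg].
move=> [df Cf] [dg Cg]; split => [x Ux|v].
  by apply: differentiableD; [exact: df|exact: dg].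
apply: eq_Ck (IH _ _ (Cf v) (Cg v)) => // x Ux /=.
by rewrite deriveD//; apply: diff_derivable; [exact: df|exact: dg].
Qed.

End CkBasics.

Section CkScalar.
Context {R : realType} {V W : normedModType R}.
Implicit Types (f g : V -> R) (U : set V).

(** The derivative f * g' + g * f' again consists of products of C^k functions,
but f and g have to be lowered from C^(k+1) to C^k, hence CkW. *)
Lemma CkM k U f g : open U -> Ck k U f -> Ck k U g -> Ck k U (f \* g).
Proof.
move=> oU; elim: k f g => [|k IH] f g.
  by move=> /= cf cg x Ux; apply: continuousM; [exact: cf|exact: cg].
move=> Cf' Cg'; have [[df Cf] [dg Cg]] := (Cf', Cg'); split => [x Ux|v].
  by apply: differentiableM; [exact: df|exact: dg].
have := CkD oU (IH _ _ (CkW Cf') (Cg v)) (IH _ _ (CkW Cg') (Cf v)).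
apply: eq_Ck => // x Ux /=.
by rewrite deriveM//; apply: diff_derivable; [exact: df|exact: dg].
Qed.

Lemma CkZl k U f (w : W) : open U -> Ck k U f -> Ck k U (fun x => f x *: w).
Proof.
move=> oU; elim: k f => [|k IH] f.
  by move=> /= cf x Ux; apply: continuousZr_tmp; exact: cf.
move=> [df Cf]; split => [x Ux|v]; first by apply: differentiableZl; exact: df.
apply: eq_Ck (IH _ (Cf v)) => // x Ux.
rewrite !deriveE ?diffZl//; do ?exact: df.
by apply: differentiableZl; exact: df.
Qed.

End CkScalar.

Section CkRow.
Context {R : realType} {V : normedModType R}.
Implicit Types (U : set V).

Lemma Ck_sum k U (W : normedModType R) n (f : 'I_n -> V -> W) :
  open U -> (forall i, Ck k U (f i)) -> Ck k U (fun x => \sum_i f i x).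
Proof.
move=> oU Cf.
have -> : (fun x => \sum_i f i x) = \sum_i f i by apply/funext => x; rewrite fct_sumE.
elim/big_ind : _ => [|g h Cg Ch|i _]; [exact: Ck_cst|exact: CkD|exact: Cf].
Qed.

Lemma Ck_row k U n (f : V -> 'rV[R]_n) : open U ->
  (forall j, Ck k U (fun x => f x 0 j)) -> Ck k U f.
Proof.
move=> oU Cf.
have -> : f = fun x => \sum_j f x 0 j *: delta_mx 0 j.
  by apply/funext => x; exact: row_sum_delta.
by apply: Ck_sum => // j; exact: CkZl.
Qed.

Lemma differentiable_entry n (f : V -> 'rV[R]_n) j x :
  differentiable f x -> differentiable (fun y => f y 0 j) x.
Proof.
by move=> df; exact: (differentiable_comp df (differentiable_coord (f x) 0 j)).
Qed.

Lemma derive_entry n (f : V -> 'rV[R]_n) v j x : differentiable f x ->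
  'D_v (fun y => f y 0 j) x = ('D_v f x) 0 j.
Proof. by move=> df; rewrite derive_mx ?mxE//; exact: diff_derivable. Qed.

Lemma Ck_entry k U n (f : V -> 'rV[R]_n) j : open U ->
  Ck k U f -> Ck k U (fun x => f x 0 j).
Proof.
move=> oU; elim: k f => [|k IH] f /=.
  move=> cf x Ux.
  have cj : {for f x, continuous (fun w : 'rV[R]_n => w 0 j)}.
    exact/differentiable_continuous/differentiable_coord.
  exact: (continuous_comp (cf x Ux) cj).
move=> [df Cf]; split => [x Ux|v]; first by apply: differentiable_entry; exact: df.
by apply: eq_Ck (IH _ (Cf v)) => // x Ux; rewrite derive_entry//; exact: df.
Qed.

End CkRow.

Section CkComp.
Context {R : realType} {V W : normedModType R}.

(** The chain rule writes a directional derivative of F o g as a sum of products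
of coordinates of a derivative of g with derivatives of F composed with g, to
which the induction hypothesis applies. The coordinates c in the basis e let
the inner space be either the scalars or the row vectors. *)
Lemma Ck_comp_coord n (e : 'I_n -> W) (c : 'I_n -> W -> R) :
    (forall w, w = \sum_j c j w *: e j) ->
    (forall j k (U : set V) (g : V -> W), open U -> Ck k U g -> Ck k U (c j \o g)) ->
  forall k (U : set V) (U' : set W) (g : V -> W) (F : W -> R), open U ->
    (forall x, U x -> U' (g x)) -> Ck k U g -> Ck k U' F -> Ck k U (F \o g).
Proof.
move=> ce Cc k U U' g F oU gU.
elim: k F => [|k IH] F.
  move=> /= cg cF x Ux; apply: continuous_comp; first exact: cg.
  by apply: cF; exact: gU.
move=> Cg CF; have [[dg Dg] [dF DF]] := (Cg, CF).
have dFg x : U x -> differentiable (F \o g) x.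
  by move=> Ux; apply: differentiable_comp; [exact: dg|exact/dF/gU].
split => // v.
have CD : Ck k U (fun x => \sum_j c j ('D_v g x) * 'D_(e j) F (g x)).
  apply: Ck_sum => // j; apply: CkM => //; first exact: (Cc j k U _ oU (Dg v)).
  exact: (IH ('D_(e j) F) (CkW Cg) (DF _)).
apply: eq_Ck CD => // x Ux.
have [dgx dFx] := (dg x Ux, dF (g x) (gU x Ux)).
rewrite [RHS]deriveE; last exact: dFg.
rewrite diff_comp//= -(deriveE v dgx) [in RHS](ce ('D_v g x)) linear_sum/=.
by apply: eq_bigr => j _; rewrite linearZ/= -deriveE.
Qed.

End CkComp.

Section CkCompCases.
Context {R : realType} {V : normedModType R}.

Lemma Ck_comp k (U : set V) (U' : set R) (g : V -> R) (F : R -> R) : open U ->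
  (forall x, U x -> U' (g x)) -> Ck k U g -> Ck k U' F -> Ck k U (F \o g).
Proof.
apply: (@Ck_comp_coord R V R 1 (fun=> 1) (fun=> id)) => //.
by move=> w; rewrite big_ord1 [RHS]mulr1.
Qed.

Lemma Ck_comp_row k n (U : set V) (U' : set 'rV[R]_n) (g : V -> 'rV[R]_n)
    (F : 'rV[R]_n -> R) : open U ->
  (forall x, U x -> U' (g x)) -> Ck k U g -> Ck k U' F -> Ck k U (F \o g).
Proof.
apply: (@Ck_comp_coord R V 'rV[R]_n n (fun j => delta_mx 0 j) (fun j w => w 0 j)).
  by move=> w; exact: row_sum_delta.
by move=> j k0 U0 g0 oU0; exact: Ck_entry.
Qed.

End CkCompCases.

Section DeriveRow.
Context {R : realType}.

Lemma derive_row n (F : 'rV[R]_n -> R) (x v : 'rV[R]_n) : differentiable F x ->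
  'D_v F x = \sum_i v 0 i * 'D_(delta_mx 0 i) F x.
Proof.
move=> dF; rewrite (deriveE v dF) [in LHS](row_sum_delta v) linear_sum.
by apply: eq_bigr => i _; rewrite (deriveE _ dF) [LHS]linearZ.
Qed.

End DeriveRow.

Section CkFunctions.
Context {R : realType}.

Lemma open_neq0 : open [set y : R | y != 0].
Proof. exact: open_neq. Qed.

Lemma open_gt0 : open [set y : R | 0 < y].
Proof. exact: open_gt. Qed.

(** The derivative of the inverse is a polynomial in the inverse. *)
Lemma Ck_inv k : Ck k [set y : R | y != 0] (fun y : R => y^-1 : R).
Proof.
elim: k => [|k IH].
  by move=> y y0; exact: inv_continuous.
split => [y y0|v].
  by apply/derivable1_diffP; apply: derivableV => //; exact: derivable_id.
have C : Ck k [set y : R | y != 0] (fun y : R => - v * (y^-1 * y^-1)).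
  apply: CkM; [exact: open_neq0|exact: (@Ck_cst R R R)|].
  by apply: CkM => //; exact: open_neq0.
apply: eq_Ck C; first exact: open_neq0.
move=> y y0; rewrite (deriveV (f := id))//= derive_id.
by rewrite expr2 invfM mulNr mulrC -mulNr.
Qed.

(** The derivative of the square root is a multiple of its own inverse. *)
Lemma Ck_sqrt k : Ck k [set y : R | 0 < y] (@Num.sqrt R).
Proof.
have ds (y : R) : 0 < y -> differentiable (@Num.sqrt R) y.
  by move=> y0; apply/derivable1_diffP; apply: ex_derive; exact: is_derive1_sqrt.
elim: k => [|k IH].
  by move=> y y0; exact: sqrt_continuous.
split => [y y0|v]; first exact: ds.
have C : Ck k [set y : R | 0 < y] (fun y : R => v / 2 * (GRing.inv \o Num.sqrt) y).
  apply: CkM; [exact: open_gt0|exact: (@Ck_cst R R R)|].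
  apply: (Ck_comp open_gt0 _ IH (Ck_inv k)) => y /= y0.
  by rewrite gt_eqF// sqrtr_gt0.
apply: eq_Ck C; first exact: open_gt0.
move=> y y0; rewrite deriveE; last exact: ds.
rewrite -[v in RHS]mulr1 [RHS]linearZ/= -deriveE; last exact: ds.
by rewrite derive_sqrt// [RHS]mulrC invfM -mulrA mulrC mulrA.
Qed.

End CkFunctions.

(** * Integrals depending on a parameter *)

Section Within.
Context {R : realType} (A : set R).
Implicit Types f g : R -> R.

Lemma withinZ (a : R) f : {within A, continuous f} ->
  {within A, continuous (fun s => a * f s)}.
Proof.
move=> cf s; apply: (@continuousM _ (subspace A) (cst a) f s); last exact: cf.
exact: cst_continuous.
Qed.

Lemma withinD f g : {within A, continuous f} -> {within A, continuous g} ->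
  {within A, continuous (f \+ g)}.
Proof.
move=> cf cg s; apply: (@continuousD _ _ (subspace A) f g s); first exact: cf.
exact: cg.
Qed.

Lemma within_sum m (f : 'I_m -> R -> R) :
  (forall i, {within A, continuous (f i)}) ->
  {within A, continuous (fun s => \sum_i f i s)}.
Proof.
move=> cf.
have -> : (fun s => \sum_i f i s) = \sum_i f i by apply/funext => s; rewrite fct_sumE.
elim/big_ind : _ => [|g h cg ch|i _]; last exact: cf.
  by move=> s; exact: cst_continuous.
exact: withinD.
Qed.

End Within.

Section UnitIntegral.
Context {R : realType}.
Notation mu := (@lebesgue_measure R).
Notation I01 := (`[0, 1]%classic : set R).

Implicit Types f g : R -> R.

Definition integral01 (f : R -> R) : R := (\int[mu]_(s in I01) f s)%R.

Let mI : measurable I01. Proof. exact: measurable_itv. Qed.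

Let int01 (f : R -> R) : {within I01, continuous f} ->
  mu.-integrable I01 (EFin \o f).
Proof. by move=> cf; apply: continuous_compact_integrable => //; exact: segment_compact. Qed.

Lemma integral01_cst (a : R) : integral01 (cst a) = a.
Proof.
rewrite /integral01 Rintegral_cst//= lebesgue_measure_itv/= lte_fin ltr01.
by rewrite oppr0 adde0 mulr1.
Qed.

Lemma integral01D f g : {within I01, continuous f} -> {within I01, continuous g} ->
  integral01 (f \+ g) = integral01 f + integral01 g.
Proof. by move=> cf cg; apply: RintegralD => //; exact: int01. Qed.

Lemma integral01Z a f : {within I01, continuous f} ->
  integral01 (fun s => a * f s) = a * integral01 f.
Proof. by move=> cf; apply: RintegralZl => //; exact: int01. Qed.

Lemma integral01_bound f (M : R) : {within I01, continuous f} ->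
  (forall s, I01 s -> `|f s| <= M) -> `|integral01 f| <= M.
Proof.
move=> cf fM; apply: le_trans (le_normr_Rintegral _ (int01 cf)) _ => //.
have cn : {within I01, continuous (fun s => `|f s|)}.
  by move=> s; apply: continuous_comp; [exact: cf|exact: norm_continuous].
have cc : {within I01, continuous (cst M : R -> R)} by move=> s; exact: cst_continuous.
rewrite -[leRHS]integral01_cst; apply: le_Rintegral => //; exact: int01.
Qed.

Lemma integral01_sum m (f : 'I_m -> R -> R) :
  (forall i, {within I01, continuous (f i)}) ->
  integral01 (fun s => \sum_i f i s) = \sum_i integral01 (f i).
Proof.
elim: m f => [|m IH] f cf.
  rewrite big_ord0 -[RHS]integral01_cst; congr integral01.
  by apply/funext => s; rewrite big_ord0.
rewrite big_ord_recl -IH//.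
rewrite -integral01D//; last by apply: within_sum.
by congr integral01; apply/funext => s; rewrite big_ord_recl.
Qed.

End UnitIntegral.

Section Line.
Context {R : realType} {V W : normedModType R}.

Lemma is_derive_line (F : V -> W) (x v : V) (t : R) :
  derivable F (x + t *: v) v ->
  is_derive t (1 : R) (fun u : R => F (x + u *: v)) ('D_v F (x + t *: v)).
Proof.
move=> dF.
have E : (fun h : R => h^-1 *: (((fun u : R => F (x + u *: v)) \o shift t) (h *: (1 : R))
             - F (x + t *: v)))
       = (fun h : R => h^-1 *: ((F \o shift (x + t *: v)) (h *: v) - F (x + t *: v))).
  apply/funext => h /=; congr (_ *: (F _ - _)).
  by rewrite [h *: 1]mulr1 scalerDl addrCA.
by split; rewrite /derivable /derive E.
Qed.

End Line.

Section MeanValue.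
Context {R : realType} {V : normedModType R}.

Lemma mean_value (F : V -> R) (x v : V) :
    (forall t : R, 0 <= t <= 1 -> differentiable F (x + t *: v)) ->
  exists2 t : R, 0 <= t <= 1 & F (x + v) - F x = 'D_v F (x + t *: v).
Proof.
move=> dF.
have dl (t : R) : t \in `[0, 1] ->
    is_derive t (1 : R) (fun u : R => F (x + u *: v)) ('D_v F (x + t *: v)).
  by rewrite in_itv/= => t01; apply/is_derive_line/diff_derivable/dF.
have h01 : (0 : R) <= 1 by exact: ler01.
have c01 : {within `[0, 1], continuous (fun u : R => F (x + u *: v))}.
  by apply: derivable_within_continuous => t /dl[].
have d01 (t : R) : t \in `]0, 1[ ->
    is_derive t (1 : R) (fun u : R => F (x + u *: v)) ('D_v F (x + t *: v)).
  by move=> /subset_itv_oo_cc/dl.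
have [t t01 E] := MVT_segment h01 d01 c01.
exists t; first by move: t01; rewrite in_itv.
by move: E; rewrite scale1r scale0r addr0 subr0 mulr1.
Qed.

End MeanValue.

Section ParametricIntegral.
Context {R : realType} {n : nat}.
Notation V := 'rV[R]_n.
Notation I01 := (`[0, 1]%classic : set R).
Implicit Types (Omega : set (R * V)) (Phi : R * V -> R).

(** The parameters for which the whole segment of integration stays in the
domain of the integrand. *)
Definition tube Omega : set V := [set x | forall s, I01 s -> Omega (s, x)].

(** Compactness of the segment: a property that holds near each of its points
holds along nearby segments. *)
Lemma near_tube (P : set (R * V)) (x : V) :
  (forall s, I01 s -> \forall p \near (s, x), P p) ->
  \forall y \near x, forall s, I01 s -> P (s, y).
Proof.
move=> Px.
have /compact_near_coveringP cov := @segment_compact R 0 1.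
apply: (cov V (nbhs x) (fun y s => P (s, y))) => s Is.
by have := Px s Is; apply: filterS => -[].
Qed.

Lemma open_tube Omega : open Omega -> open (tube Omega).
Proof.
move=> oO; rewrite openE => x Ox; apply: near_tube => s Is.
by apply: open_nbhs_nbhs; split => //; exact: Ox.
Qed.

(** By near_tube, continuity at the points of the segment is uniform along it. *)
Lemma near_slice Omega Phi (x : V) (e : R) : 0 < e ->
    (forall p, Omega p -> {for p, continuous Phi}) -> tube Omega x ->
  \forall y \near x, forall s, I01 s -> `|Phi (s, y) - Phi (s, x)| < e.
Proof.
move=> e0 cP Ox; apply: (@near_tube (fun p => `|Phi p - Phi (p.1, x)| < e)).
move=> s Is.
have cPs := cP _ (Ox s Is).
have e20 : 0 < e / 2 by rewrite divr_gt0.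
have N1 : \forall p \near (s, x), `|Phi (s, x) - Phi p| < e / 2.
  by move/cvgrPdist_lt : cPs; apply.
have N2 : \forall p \near (s, x), `|Phi (s, x) - Phi (p.1, x)| < e / 2.
  have cpr : {for (s, x), continuous (fun p : R * V => (p.1, x))}.
    apply: (@cvg_pair _ _ _ _ (nbhs s) (nbhs x)); first exact: cvg_fst.
    exact: cvg_cst.
  have := continuous_comp cpr cPs.
  by move/cvgrPdist_lt; apply.
apply: filterS2 N1 N2 => p H1 H2.
by rewrite -(subrKA (Phi (s, x))) (le_lt_trans (ler_normD _ _))// (splitr e) ltrD// distrC.
Qed.

Lemma slice_continuous Omega Phi (x : V) :
    (forall p, Omega p -> {for p, continuous Phi}) -> tube Omega x ->
  {within I01, continuous (fun s => Phi (s, x))}.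
Proof.
move=> cP Ox; apply: continuous_in_subspaceT => s /set_mem Is.
have cpr : {for s, continuous (fun s : R => (s, x))}.
  by apply: (@cvg_pair _ _ _ _ (nbhs s) (nbhs x)); [exact: cvg_id|exact: cvg_cst].
exact: (continuous_comp cpr (cP _ (Ox s Is))).
Qed.

Lemma continuous_integral01 Omega Phi (x : V) :
    open Omega -> (forall p, Omega p -> {for p, continuous Phi}) -> tube Omega x ->
  {for x, continuous (fun y => integral01 (fun s => Phi (s, y)))}.
Proof.
move=> oO cP Ox.
apply/(cvgrPdist_le (F := nbhs x) (FF := nbhs_filter x)) => e e0.
have Oy : \forall y \near x, tube Omega y.
  by apply: open_nbhs_nbhs; split => //; exact: open_tube.
apply: filterS2 Oy (near_slice e0 cP Ox) => y Oy Py.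
have cx := slice_continuous cP Ox; have cy := slice_continuous cP Oy.
have cNy : {within I01, continuous (fun s => -1 * Phi (s, y))} by exact: withinZ.
rewrite -mulN1r -integral01Z// -integral01D//.
apply: integral01_bound => [|s Is] /=; first exact: withinD.
by rewrite mulN1r distrC ltW// Py.
Qed.

Lemma slice_line (s t : R) (x h : V) :
  (s, x) + t *: (0, h) = (s, x + t *: h) :> R * V.
Proof.
have s0 : s + t * 0 = s by rewrite mulr0 addr0.
by apply: injective_projections; first exact: s0.
Qed.

Definition partial (j : 'I_n) Phi : R * V -> R := 'D_((0 : R), delta_mx 0 j) Phi.

Lemma derive_partial Phi p (h : V) : differentiable Phi p ->
  'D_((0 : R), h) Phi p = \sum_j h 0 j * partial j Phi p.
Proof.
move=> dP; rewrite deriveE//.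
have -> : (0 : R, h) = \sum_j h 0 j *: (0 : R, delta_mx 0 j : V).
  apply: injective_projections.
    by rewrite (linear_sum fst) big1// => j _ /=; exact: mulr0.
  by rewrite (linear_sum snd) /= [LHS]row_sum_delta.
by rewrite linear_sum; apply: eq_bigr => j _; rewrite linearZ/= /partial deriveE.
Qed.

(** Differentiation under the integral sign. By the mean value theorem the error
of the linear approximation of the integrand is controlled by the oscillation
of its partial derivatives, which near_slice makes small uniformly in the
variable of integration. *)
Lemma differentiable_integral01 Omega Phi (x : V) : open Omega ->
    (forall p, Omega p -> differentiable Phi p) ->
    (forall j p, Omega p -> {for p, continuous (partial j Phi)}) -> tube Omega x ->
  let I := fun y => integral01 (fun s => Phi (s, y)) in
  differentiable I x /\
  forall h, 'd I x h = \sum_j h 0 j * integral01 (fun s => partial j Phi (s, x)).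
Proof.
move=> oO dP cp Ox I.
pose a j := integral01 (fun s => partial j Phi (s, x)).
pose l (h : V) : R := \sum_j h 0 j * a j.
have linl : linear l.
  move=> c u v; rewrite /l scaler_sumr -big_split/=; apply: eq_bigr => j _.
  by rewrite !mxE mulrDl -mulrA.
pose lM := GRing.isLinear.Build _ _ _ _ _ linl.
pose L : {linear V -> R} := HB.pack l lM.
have cL : continuous L.
  move=> h; apply: (@Ck_continuous R V R 0 setT) => //.
  apply: Ck_sum; first exact: openT.
  move=> j; apply: CkM; [exact: openT| |exact: Ck_cst].
  apply: (@Ck_entry R V 0 setT n id j); first exact: openT.
  exact: (@Ck_linear R V V 0 setT idfun (fun=> cvg_id)).
suff [dI dE] : differentiable I x /\ 'd I x = L :> (V -> R).
  by split => // h; rewrite dE.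
apply: differentiable_by_estimate => // e e0.
have cP p : Omega p -> {for p, continuous Phi}.
  by move=> /dP; exact: differentiable_continuous.
(* There are n partial derivatives; n + 1 also covers n = 0. *)
pose e' := e / n.+1%:R.
have e'0 : 0 < e' by rewrite divr_gt0.
have Oy : \forall y \near x, tube Omega y.
  by apply: open_nbhs_nbhs; split => //; exact: open_tube.
have Ny : \forall y \near x, forall j s, I01 s ->
    `|partial j Phi (s, y) - partial j Phi (s, x)| < e'.
  by apply: (filter_forall (nbhs_filter x)) => j; exact: near_slice (cp j) Ox.
have [d /= d0 dball] := (nbhs_ballP _ _).1 (filterI Oy Ny).
have Nd : \forall h \near (0 : V), `|h| < d.
  apply/nbhs_ballP; exists d => // h; rewrite -ball_normE/= sub0r normrN.
  exact.
apply: filterS Nd => h hd.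
have inball (t : R) : 0 <= t <= 1 -> ball x d (x + t *: h).
  move=> /andP[t0 t1]; rewrite -ball_normE/= opprD addrA subrr sub0r normrN.
  by rewrite normrZ ger0_norm// (le_lt_trans _ hd)// ler_piMl.
have Oxh : tube Omega (h + x).
  have [] := dball (x + 1 *: h) (inball 1 _); first by rewrite ler01 lexx.
  by rewrite scale1r addrC.
have c1 := slice_continuous cP Ox.
have c2 := slice_continuous cP Oxh.
have c3 j : {within I01, continuous (fun s => partial j Phi (s, x))}.
  exact: slice_continuous (cp j) Ox.
pose D s := Phi (s, h + x) - Phi (s, x) - \sum_j h 0 j * partial j Phi (s, x).
have c3h j : {within I01, continuous (fun s => h 0 j * partial j Phi (s, x))}.
  exact: withinZ.
have c4 : {within I01, continuous (fun s => \sum_j h 0 j * partial j Phi (s, x))}.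
  exact: within_sum.
have DE : I (h + x) - I x - L h = integral01 D.
  have -> : L h = integral01 (fun s => \sum_j h 0 j * partial j Phi (s, x)).
    rewrite integral01_sum//; apply: eq_bigr => j _; exact/esym/integral01Z.
  rewrite -mulN1r -(mulN1r (integral01 _)) -!integral01Z// -!integral01D//.
  - by congr integral01; apply/funext => s; rewrite /D/= !mulN1r.
  - by apply: withinD => //; exact: withinZ.
  - exact: withinZ.
  - exact: withinZ.
have cD : {within I01, continuous D}.
  have -> : D = (fun s => Phi (s, h + x)) \+ (fun s => -1 * Phi (s, x)) \+
       (fun s => -1 * \sum_j h 0 j * partial j Phi (s, x)).
    by apply/funext => s; rewrite /D/= !mulN1r.
  by apply: withinD; [apply: withinD => //; exact: withinZ|exact: withinZ].
rewrite DE; apply: integral01_bound => // s Is.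
have [t t01|t t01 E] := @mean_value R (R * V)%type Phi (s, x) (0, h).
  rewrite slice_line; apply: dP; have [Ot _] := dball _ (inball t t01); exact: Ot.
have [Ot Nt] := dball _ (inball t t01).
rewrite slice_line derive_partial in E; last by apply: dP; exact: Ot.
have -> : D s = \sum_j h 0 j * (partial j Phi (s, x + t *: h) - partial j Phi (s, x)).
  rewrite /D (_ : (s, h + x) = (s, x) + (0, h)); last first.
    by rewrite -[(0, h)]scale1r slice_line scale1r addrC.
  by rewrite E -sumrB; apply: eq_bigr => j _; rewrite mulrBr.
apply: le_trans (ler_norm_sum _ _ _) _.
have hj j : `|h 0 j| <= `|h|.
  rewrite [leRHS]/Num.Def.normr/= mx_normrE; exact: (le_bigmax _ _ (ord0, j)).
apply: (@le_trans _ _ (\sum_(j < n) `|h| * e')).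
  by apply: ler_sum => j _; rewrite normrM ler_pM// ltW// Nt.
rewrite sumr_const card_ord -mulr_natr -mulrA (mulrC e).
apply: ler_wpM2l; first exact: normr_ge0.
by rewrite /e' mulrAC ler_pdivrMr// ler_pM2l// ler_nat.
Qed.

(** The partial derivatives of such an integral are integrals of the same kind. *)
Lemma Ck_integral01 k Omega Phi : open Omega -> (forall k, Ck k Omega Phi) ->
  Ck k (tube Omega) (fun y => integral01 (fun s => Phi (s, y))).
Proof.
move=> oO; elim: k Phi => [|k IH] Phi CP.
  by move=> x; apply: continuous_integral01 oO (CP 0).
have dP p : Omega p -> differentiable Phi p by have [+ _] := CP 1; apply.
have Cp j k' : Ck k' Omega (partial j Phi) by have [_] := CP k'.+1; exact.
have dI x := differentiable_integral01 oO dP (fun j => Cp j 0) (x := x).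
have oT := open_tube oO.
split => [x /dI[]//|v].
have CS : Ck k (tube Omega)
    (fun x => \sum_j v 0 j * integral01 (fun s => partial j Phi (s, x))).
  apply: Ck_sum => // j; apply: CkM => //; first exact: Ck_cst.
  exact: IH.
by apply: eq_Ck CS => // x /dI[dIx dE]; rewrite deriveE.
Qed.

End ParametricIntegral.

(** * Division by the equation of the sphere *)

Section Radius.
Context {R : realType}.

Lemma dotpZl n a (x y : 'rV[R]_n) : dotp (a *: x) y = a * dotp x y.
Proof. by rewrite /dotp mulr_sumr; apply: eq_bigr => i _; rewrite mxE mulrA. Qed.

Lemma dotpC n (x y : 'rV[R]_n) : dotp x y = dotp y x.
Proof. by apply: eq_bigr => i _; rewrite mulrC. Qed.

Lemma dotp_ge0 n (x : 'rV[R]_n) : 0 <= dotp x x.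
Proof. by apply: sumr_ge0 => i _; rewrite -expr2 sqr_ge0. Qed.

Lemma dotp_eq0 n (x : 'rV[R]_n) : (dotp x x == 0) = (x == 0).
Proof.
apply/idP/eqP => [|->]; last by rewrite /dotp big1// => i _; rewrite mxE mul0r.
rewrite psumr_eq0 => [/allP x0|i _]; last by rewrite -expr2 sqr_ge0.
apply/rowP => i; rewrite mxE; apply/eqP.
by rewrite -sqrf_eq0 expr2; apply: x0; rewrite mem_index_enum.
Qed.

Lemma radius_sqr n (x : 'rV[R]_n) : radius x ^+ 2 = dotp x x.
Proof. by rewrite sqr_sqrtr// dotp_ge0. Qed.

Lemma radius_ge0 n (x : 'rV[R]_n) : 0 <= radius x.
Proof. exact: sqrtr_ge0. Qed.

Lemma usphereE n (x : 'rV[R]_n) : usphere x <-> dotp x x = 1.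
Proof.
rewrite -radius_sqr; split => [/= ->|/eqP]; first by rewrite expr1n.
by rewrite sqrf_eq1 => /orP[/eqP//|/eqP E]; have := radius_ge0 x; rewrite E oppr_ge0 ler10.
Qed.

Lemma uballE n (x : 'rV[R]_n) : uball x <-> dotp x x <= 1.
Proof.
rewrite /uball/= -radius_sqr; split => [x1|]; first by rewrite expr_le1// radius_ge0.
by rewrite expr_le1// radius_ge0.
Qed.

Lemma Ck_dotp k (V : normedModType R) (U : set V) n (f g : V -> 'rV[R]_n) :
  open U -> Ck k U f -> Ck k U g -> Ck k U (fun x => dotp (f x) (g x)).
Proof.
move=> oU Cf Cg; apply: Ck_sum => // i.
by apply: CkM => //; exact: Ck_entry.
Qed.

Lemma Ck_id k (V : normedModType R) (U : set V) : Ck k U (@id V).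
Proof. exact: (@Ck_linear R V V k U idfun (fun=> cvg_id)). Qed.

Lemma Ck_fst k (V W : normedModType R) (U : set (V * W)) : Ck k U (@fst V W).
Proof. by apply: (@Ck_linear _ _ _ k U fst) => p; exact: cvg_fst. Qed.

Lemma Ck_snd k (V W : normedModType R) (U : set (V * W)) : Ck k U (@snd V W).
Proof. by apply: (@Ck_linear _ _ _ k U snd) => p; exact: cvg_snd. Qed.

Lemma Ck_scale k (V : normedModType R) (U : set V) n (a : V -> R) (f : V -> 'rV[R]_n) :
  open U -> Ck k U a -> Ck k U f -> Ck k U (fun x => a x *: f x).
Proof.
move=> oU Ca Cf; apply: Ck_row => // j.
have : Ck k U (fun x => a x * f x 0 j) by apply: CkM => //; exact: Ck_entry.
by apply: eq_Ck => // x _; rewrite mxE.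
Qed.

Lemma Ck_inv_comp k (V : normedModType R) (U : set V) (a : V -> R) :
  open U -> (forall x, U x -> a x != 0) -> Ck k U a -> Ck k U (fun x => (a x)^-1).
Proof. by move=> oU a0 Ca; exact: (Ck_comp oU a0 Ca (Ck_inv k)). Qed.

Lemma Ck_sqrt_comp k (V : normedModType R) (U : set V) (a : V -> R) :
  open U -> (forall x, U x -> 0 < a x) -> Ck k U a -> Ck k U (fun x => Num.sqrt (a x)).
Proof. by move=> oU a0 Ca; exact: (Ck_comp oU a0 Ca (Ck_sqrt k)). Qed.

Lemma open_preimage (V W : normedModType R) (U : set V) (U' : set W) (f : V -> W) :
  open U -> (forall x, U x -> {for x, continuous f}) -> open U' ->
  open [set x | U x /\ U' (f x)].
Proof.
move=> oU cf oU'; rewrite openE => x [Ux U'fx].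
have N1 : nbhs x U by apply: open_nbhs_nbhs.
have N2 : nbhs (f x) U' by apply: open_nbhs_nbhs.
exact: filterI N1 (cf x Ux _ N2).
Qed.

End Radius.

Section Division.
Context {R : realType} {n : nat}.
Notation V := 'rV[R]_n.
Notation I01 := (`[0, 1]%classic : set R).

(** The segment from x / |x|, at time 0, to x, at time 1, written as a base point
plus time times a vector so that its derivative can be read off. *)
Definition ray (p : R * V) : V :=
  (radius p.2)^-1 *: p.2 + p.1 *: ((1 - (radius p.2)^-1) *: p.2).

Lemma ray_sphere x : usphere x -> forall s, ray (s, x) = x.
Proof. by move=> x1 s; rewrite /ray/= x1 invr1 subrr scale0r scaler0 addr0 scale1r. Qed.

Lemma ray1 (x : V) : ray (1, x) = x.
Proof. by rewrite /ray/= scale1r -scalerDl addrC subrK scale1r. Qed.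

Lemma usphere_ray0 (x : V) : x != 0 -> usphere (ray (0, x)).
Proof.
move=> x0; apply/usphereE; rewrite /ray/= scale0r addr0 dotpZl dotpC dotpZl.
rewrite -radius_sqr mulrA -expr2 -exprMn mulVf ?expr1n//.
by rewrite -sqrf_eq0 radius_sqr dotp_eq0.
Qed.

Let Omega0 : set (R * V) := [set p | 0 < dotp p.2 p.2].

Let oOmega0 : open Omega0.
Proof.
have cd p : setT p -> {for p, continuous (fun p : R * V => dotp p.2 p.2)}.
  apply: (@Ck_continuous _ _ _ 0).
  by apply: Ck_dotp; [exact: openT|exact: Ck_snd|exact: Ck_snd].
have := open_preimage openT cd open_gt0.
by congr open; apply/seteqP; split => p //= -[].
Qed.

Let Ck_rinv k : Ck k Omega0 (fun p => (radius p.2)^-1).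
Proof.
apply: Ck_inv_comp => // [p p0|]; first by rewrite gt_eqF// sqrtr_gt0.
apply: Ck_sqrt_comp => //.
by apply: Ck_dotp => //; exact: Ck_snd.
Qed.

Let Ck_ray k : Ck k Omega0 ray.
Proof.
apply: CkD => //; first by apply: Ck_scale => //; exact: Ck_snd.
apply: Ck_scale => //; first exact: Ck_fst.
apply: Ck_scale => //; last exact: Ck_snd.
have : Ck k Omega0 (fun p => 1 + -1 * (radius p.2)^-1).
  apply: CkD => //; first exact: Ck_cst.
  by apply: CkM => //; exact: Ck_cst.
by apply: eq_Ck => // p _; rewrite mulN1r.
Qed.

Section OneFunction.
Variables (U : set V) (p : V -> R).
Hypotheses (oU : open U) (Cp : forall k, Ck k U p).
Hypothesis (p0 : forall x, U x -> usphere x -> p x = 0).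

Let Omega : set (R * V) := [set y | Omega0 y /\ U (ray y)].

Let oOmega : open Omega.
Proof. by apply: open_preimage => // y; exact: (Ck_continuous (Ck_ray 0)). Qed.

Let OmegaW : Omega `<=` Omega0. Proof. by move=> y []. Qed.

Let T : set V := tube Omega.

Let oT : open T. Proof. exact: open_tube. Qed.

Let I0 : I01 0. Proof. by rewrite /= in_itv/= lexx ler01. Qed.

Let T_dotp x : T x -> 0 < dotp x x. Proof. by move=> /(_ 0 I0)[]. Qed.

Let T_neq0 x : T x -> x != 0.
Proof. by move=> /T_dotp; rewrite lt0r dotp_eq0 => /andP[]. Qed.

Let T_radius x : T x -> 0 < radius x. Proof. by move=> /T_dotp; rewrite sqrtr_gt0. Qed.

Let sphere_T x : U x -> usphere x -> T x.
Proof.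
move=> Ux x1 s Is; split; last by rewrite ray_sphere.
by have /usphereE/= := x1; rewrite /Omega0/= => ->; exact: ltr01.
Qed.

(* The derivative of p along the ray is (1 - 1 / |x|) times this function, so
   that the factor that vanishes on the sphere is already split off. *)
Let Phi (y : R * V) : R := \sum_i y.2 0 i * 'D_(delta_mx 0 i) p (ray y).

Let C1p k v : Ck k U ('D_v p). Proof. by have [_] := Cp k.+1; exact. Qed.

Let Ck_Phi k : Ck k Omega Phi.
Proof.
apply: Ck_sum => // i; apply: CkM => //; first by apply: Ck_entry => //; exact: Ck_snd.
have rU y : Omega y -> U (ray y) by case.
exact: (Ck_comp_row oOmega rU (Ck_subset OmegaW (Ck_ray k)) (C1p k _)).
Qed.

Let dp x : U x -> differentiable p x. Proof. by have [+ _] := Cp 1; exact. Qed.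

Let average x := integral01 (fun s => Phi (s, x)).

Let p_average x : T x -> p x = (1 - (radius x)^-1) * average x.
Proof.
move=> Tx; pose c := 1 - (radius x)^-1.
have UT s : I01 s -> U (ray (s, x)) by move=> /Tx[].
have cPhi : {within I01, continuous (fun s => Phi (s, x))}.
  exact: (@slice_continuous _ _ Omega Phi x (Ck_Phi 0) Tx).
have dF s : I01 s -> is_derive s (1 : R) (fun t => p (ray (t, x))) (c * Phi (s, x)).
  move=> Is.
  have dps : derivable p (ray (s, x)) (c *: x) by apply/diff_derivable/dp/UT.
  have -> : c * Phi (s, x) = 'D_(c *: x) p (ray (s, x)).
    rewrite derive_row; last exact/dp/UT.
    by rewrite mulr_sumr; apply: eq_bigr => i _; rewrite mxE mulrA.
  exact: is_derive_line dps.
have cF : {within I01, continuous (fun t => p (ray (t, x)))}.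
  by apply: derivable_within_continuous => t /dF[].
have E := @continuous_FTC2 R (fun s => c * Phi (s, x)) (fun t => p (ray (t, x))) 0 1
  ltr01 (withinZ cPhi).
have -> : p x = p (ray (1, x)) - p (ray (0, x)).
  rewrite ray1 (p0 (x := ray (0, x))) ?subr0//; first exact: UT.
  exact/usphere_ray0/T_neq0.
rewrite -integral01Z// /integral01 /Rintegral E//.
- have [cF0 cFl cFr] := (continuous_within_itvP _ ltr01).1 cF.
  by split => // s /subset_itv_oo_cc/dF[].
- by move=> s /subset_itv_oo_cc/dF[_ <-]; rewrite derive1E.
Qed.

(** Hadamard's lemma for the unit sphere. Near the sphere p x is 1 - 1 / |x| times
the average of Phi, and 1 - 1 / |x| = - (1 - |x|^2) / (|x| (|x| + 1)). *)
Lemma sphere_division :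
  exists q : V -> R, (forall k, Ck k U q) /\
    forall x, U x -> p x = (1 - dotp x x) * q x.
Proof.
pose I x := - (radius x * (radius x + 1))^-1 * average x.
have pI x : T x -> p x = (1 - dotp x x) * I x.
  move=> Tx; have r0 := T_radius Tx; rewrite (p_average Tx) /I -radius_sqr.
  have n0 : radius x != 0 by rewrite gt_eqF.
  have n1 : radius x + 1 != 0 by rewrite gt_eqF// addr_gt0.
  by field; rewrite ?n0 ?n1.
pose q x := if 1 - dotp x x == 0 then I x else p x / (1 - dotp x x).
have pq x : U x -> p x = (1 - dotp x x) * q x.
  move=> Ux; rewrite /q; case: eqVneq => [w0|w0]; last by rewrite mulrC divfK.
  rewrite w0 mul0r p0//; apply/usphereE; apply/eqP.
  by rewrite eq_sym -subr_eq0 w0.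
have qI x : T x -> I x = q x.
  move=> Tx; rewrite /q; case: eqVneq => // w0.
  by rewrite (pI _ Tx) mulrC mulKf.
exists q; split => // k.
have Cw (U' : set V) k' : open U' -> Ck k' U' (fun x : V => 1 - dotp x x).
  move=> oU'; have : Ck k' U' (fun x : V => 1 + -1 * dotp x x).
    apply: CkD => //; first exact: Ck_cst.
    apply: CkM => //; first exact: Ck_cst.
    by apply: Ck_dotp => //; exact: Ck_id.
  by apply: eq_Ck => // x _; rewrite mulN1r.
pose U1 : set V := [set x | U x /\ 1 - dotp x x != 0].
have oU1 : open U1.
  apply: (open_preimage oU _ open_neq0) => x.
  exact: (Ck_continuous (Cw U 0 oU)).
have CT : Ck k T q.
  have : Ck k T I.
    have Cr : Ck k T (fun x => radius x).
      apply: Ck_sqrt_comp => //; apply: Ck_dotp => //; exact: Ck_id.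
    apply: CkM => //; last exact: Ck_integral01.
    have : Ck k T (fun x => -1 * (radius x * (radius x + 1))^-1).
      apply: CkM => //; first exact: Ck_cst.
      apply: Ck_inv_comp => // [x Tx|].
        have r0 := T_radius Tx.
        by rewrite gt_eqF// mulr_gt0// addr_gt0.
      by apply: CkM => //; apply: CkD => //; exact: Ck_cst.
    by apply: eq_Ck => // x _; rewrite mulN1r.
  exact: eq_Ck.
have C1 : Ck k U1 q.
  have : Ck k U1 (fun x => p x * (1 - dotp x x)^-1).
    apply: CkM => //; first by apply: Ck_subset (Cp k) => x [].
    by apply: Ck_inv_comp => // [x []//|]; exact: Cw.
  by apply: eq_Ck => // x [_ w0]; rewrite /q (negbTE w0).
apply: Ck_subset (Ck_setU C1 CT) => x Ux.
have [w0|w0] := eqVneq (1 - dotp x x) 0; last by left.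
right; apply: sphere_T => //; apply/usphereE; apply/eqP.
by rewrite eq_sym -subr_eq0 w0.
Qed.

End OneFunction.
End Division.

(** * Index of a Hessian with one more positive direction *)

Section BlockHessian.
Context {R : realType} {k : nat}.
Implicit Types (H : 'M[R]_k) (c : R).

Definition stabilized H c : 'M[R]_(k + 1) := block_mx H 0 0 c%:M.

Lemma stabilized_unit H c : c != 0 -> H \in unitmx -> stabilized H c \in unitmx.
Proof.
move=> c0; rewrite !unitmxE det_ublock det_scalar expr1 !unitfE => H0.
by rewrite mulf_neq0.
Qed.

Lemma stabilized_form H c (u : 'rV[R]_k) (t : 'rV[R]_1) :
  (row_mx u t *m stabilized H c *m (row_mx u t)^T) 0 0
    = (u *m H *m u^T) 0 0 + c * t 0 0 ^+ 2.
Proof.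
rewrite /stabilized mul_row_block !mulmx0 addr0 add0r tr_row_mx mul_row_col mxE.
congr (_ + _); rewrite mul_mx_scalar -scalemxAl mxE; congr (c * _).
by rewrite mxE big_ord1 mxE expr2.
Qed.

(** If the enlarged form is negative definite on W, then W meets the new positive
line only in 0, and the projection of W forgetting that line is injective and
only makes the form more negative; conversely a negative definite subspace of H
remains one. *)
Lemma stabilized_index H c d : 0 < c -> has_index (stabilized H c) d -> has_index H d.
Proof.
move=> c0 [[W [Wd Wneg]] maxd].
split; last first.
  move=> Z Zneg; apply: leq_trans (maxd (block_mx Z 0 0 0) _).
    by rewrite rank_diag_block_mx mxrank0 addn0.
  move=> v /submxP[B ->].
  rewrite -[B]hsubmxK mul_row_block !mulmx0 !addr0 => v0.
  rewrite stabilized_form [X in c * X ^+ 2]mxE expr0n mulr0 addr0; apply: Zneg; first exact: submxMl.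
  by apply: contra v0 => /eqP->; rewrite row_mx0.
pose P : 'M[R]_(k + 1, k) := col_mx 1%:M 0.
have lP (v : 'rV[R]_(k + 1)) : v *m P = lsubmx v.
  by rewrite -[v in LHS]hsubmxK mul_row_col mulmx1 mulmx0 addr0.
have neg (v : 'rV[R]_(k + 1)) : (v <= W)%MS -> v != 0 ->
    (lsubmx v *m H *m (lsubmx v)^T) 0 0 < 0.
  move=> vW v0; have := Wneg v vW v0.
  rewrite -{1 2}[v]hsubmxK stabilized_form; apply: le_lt_trans.
  by rewrite lerDl mulr_ge0 ?sqr_ge0// ltW.
exists <<W *m P>>%MS; split; last first.
  move=> u; rewrite genmxE => /submxP[B ->]; rewrite mulmxA => u0.
  rewrite lP; apply: neg; first exact: submxMl.
  by apply: contra u0 => /eqP->; rewrite mul0mx.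
rewrite mxrank_gen -Wd; apply/mxrank_injP; rewrite -submx0.
apply/rV_subP => v; rewrite sub_capmx => /andP[vW /sub_kermxP vP].
have [->|v0] := eqVneq v 0; first exact: sub0mx.
by have := neg v vW v0; rewrite -lP vP !mul0mx mxE ltxx.
Qed.

End BlockHessian.

(** * Derivatives of the radius *)

Section DeriveFacts.
Context {R : realType}.

Lemma derive_ge0_min (V : normedModType R) (F : V -> R) (x v : V) :
  (forall y, 0 <= F y) -> F x = 0 -> derivable F x v -> 0 <= 'D_v F x.
Proof.
move=> F0 Fx dF.
have cv : (fun h => h^-1 *: ((F \o shift x) (h *: v) - F x)) @ 0^'+ --> 'D_v F x.
  exact: (cvg_dnbhs_at_right dF).
apply: (cvgr_to_ge cv).
near=> h; rewrite /= Fx subr0; apply: mulr_ge0 => //.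
by rewrite invr_ge0 ltW.
Unshelve. all: by end_near. Qed.

(** The derivatives in the directions v and - v are both nonnegative, and they are
opposite. *)
Lemma derive_min (V : normedModType R) (F : V -> R) (x v : V) :
  (forall y, 0 <= F y) -> F x = 0 -> differentiable F x -> 'D_v F x = 0.
Proof.
move=> F0 Fx dF; apply/eqP; rewrite eq_le; apply/andP; split; last first.
  by apply: derive_ge0_min => //; exact: diff_derivable.
rewrite -oppr_ge0 deriveE// -[leRHS]linearN -deriveE//.
by apply: derive_ge0_min => //; exact: diff_derivable.
Qed.

Lemma derive_dotp (V : normedModType R) n (f g : V -> 'rV[R]_n) (x v : V) :
  differentiable f x -> differentiable g x ->
  'D_v (fun y => dotp (f y) (g y)) x = dotp ('D_v f x) (g x) + dotp (f x) ('D_v g x).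
Proof.
move=> df dg.
have dfi i := diff_derivable (v := v) (differentiable_entry i df).
have dgi i := diff_derivable (v := v) (differentiable_entry i dg).
have -> : (fun y => dotp (f y) (g y)) =
    \sum_i ((fun y => f y 0 i) * (fun y => g y 0 i)).
  by apply/funext => y; rewrite fct_sumE.
rewrite derive_sum => [|i]; last exact: derivableM.
rewrite /dotp -big_split/=; apply: eq_bigr => i _.
rewrite deriveM// !derive_entry// addrC; congr (_ + _); exact: mulrC.
Qed.

Lemma norm_entry_radius n (x : 'rV[R]_n) j : `|x 0 j| <= radius x.
Proof.
rewrite -sqrtr_sqr ler_wsqrtr// /dotp (bigD1 j)//= expr2 lerDl.
by apply: sumr_ge0 => i _; rewrite -expr2 sqr_ge0.
Qed.

Lemma derive_radius (V : normedModType R) n (g : V -> 'rV[R]_n) (x v : V) :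
    differentiable g x -> differentiable (fun y => radius (g y)) x ->
  radius (g x) * 'D_v (fun y => radius (g y)) x = dotp ('D_v g x) (g x).
Proof.
move=> dg dr.
have : 'D_v (fun y => dotp (g y) (g y)) x =
    'D_v ((fun y => radius (g y)) * (fun y => radius (g y))) x.
  by congr ('D_v _ x); apply/funext => y; rewrite -radius_sqr.
rewrite derive_dotp// deriveM; try exact: diff_derivable.
rewrite [dotp (g x) _]dotpC -!mulr2n => /eqP.
by rewrite -subr_eq0 -mulrnBl mulrn_eq0/= subr_eq0 => /eqP ->.
Qed.

(** The radius has a minimum at a zero of g, so its derivative vanishes there; each
coordinate of g is dominated by the radius, so adding it gives another
nonnegative function with a minimum. *)
Lemma radius_singular (V : normedModType R) n (g : V -> 'rV[R]_n) (x v : V) :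
    differentiable g x -> differentiable (fun y => radius (g y)) x ->
  g x = 0 -> 'D_v g x = 0.
Proof.
move=> dg dr gx; apply/rowP => j; rewrite mxE -derive_entry//.
have dj := differentiable_entry j dg.
have rx : radius (g x) = 0 by rewrite gx /Defs.radius (eqP _ : dotp _ _ = 0) ?sqrtr0 ?dotp_eq0.
have gj : g x 0 j = 0 by rewrite gx mxE.
have b y : `|g y 0 j| <= radius (g y) by exact: norm_entry_radius.
have hr : 'D_v (fun y => radius (g y)) x = 0.
  by apply: derive_min => // y; exact: radius_ge0.
have := @derive_min V ((fun y => radius (g y)) + (fun y => g y 0 j)) x v.
rewrite deriveD; try exact: diff_derivable.
rewrite hr add0r; apply.
- move=> y; rewrite -[_ y]/(radius (g y) + g y 0 j).
  by have := b y; rewrite ler_norml => /andP[+ _]; rewrite lerNl -subr_ge0 opprK.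
- by rewrite -[_ x]/(radius (g x) + g x 0 j) rx gj addr0.
- exact: differentiableD.
Qed.

End DeriveFacts.

(** * Row vectors with a distinguished last coordinate *)

Section LastCoordinate.
Context {R : realType} {k : nat}.
Implicit Types (x u : 'rV[R]_k) (y v : 'rV[R]_(k + 1)) (s t : R).

Definition height y : R := y 0 (rshift k ord0).

Definition at_height x t : 'rV[R]_(k + 1) := row_mx x (const_mx t).

Lemma at_heightK y : at_height (lsubmx y) (height y) = y.
Proof.
rewrite -[RHS]hsubmxK; congr row_mx; apply/rowP => j.
by rewrite ord1 !mxE.
Qed.

Lemma lsubmx_at_height x t : lsubmx (at_height x t) = x.
Proof. exact: row_mxKl. Qed.

Lemma height_at_height x t : height (at_height x t) = t.
Proof. by rewrite /height /at_height row_mxEr mxE. Qed.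

Lemma at_heightD x u t s : at_height x t + at_height u s = at_height (x + u) (t + s).
Proof. by rewrite /at_height add_row_mx; congr row_mx; apply/rowP => j; rewrite !mxE. Qed.

Lemma at_heightZ a x t : a *: at_height x t = at_height (a *: x) (a * t).
Proof. by rewrite /at_height scale_row_mx; congr row_mx; apply/rowP => j; rewrite !mxE. Qed.

Lemma at_height_eq0 x t : at_height x t = 0 -> x = 0 /\ t = 0.
Proof.
move=> E; have := height_at_height x t; have := lsubmx_at_height x t.
by rewrite E linear0 /height mxE.
Qed.

Lemma dotp_at_height x u t s :
  dotp (at_height x t) (at_height u s) = dotp x u + t * s.
Proof.
rewrite /dotp big_split_ord/= big_ord1; congr (_ + _); last first.
  by rewrite !row_mxEr !mxE.
by apply: eq_bigr => i _; rewrite !row_mxEl.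
Qed.

Definition base_direction i : 'rV[R]_(k + 1) := at_height (delta_mx 0 i) 0.
Definition up : 'rV[R]_(k + 1) := at_height 0 1.

Lemma delta_lshift i : delta_mx 0 (lshift 1 i) = base_direction i.
Proof. by rewrite /base_direction /at_height delta_mx_lshift. Qed.

Lemma delta_rshift j : delta_mx 0 (rshift k j) = up.
Proof.
rewrite /up /at_height ord1 delta_mx_rshift; congr row_mx.
by apply/rowP => j'; rewrite ord1 !mxE.
Qed.

Section Derivatives.
Variable W : normedModType R.

Lemma derive_lsubmx (F : 'rV[R]_k -> W) v y :
  'D_v (fun z : 'rV[R]_(k + 1) => F (lsubmx z)) y = 'D_(lsubmx v) F (lsubmx y).
Proof.
have E : (fun h : R => h^-1 *: (((fun z => F (lsubmx z)) \o shift y) (h *: v) - F (lsubmx y)))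
       = (fun h : R => h^-1 *: ((F \o shift (lsubmx y)) (h *: lsubmx v) - F (lsubmx y))).
  apply/funext => h /=; congr (_ *: (F _ - _)).
  by apply/rowP => i; rewrite !mxE.
by rewrite /derive E.
Qed.

Lemma derive_slice (F : 'rV[R]_(k + 1) -> W) u x t :
  'D_(at_height u 0) F (at_height x t) = 'D_u (fun z => F (at_height z t)) x.
Proof.
have E : (fun h : R => h^-1 *: ((F \o shift (at_height x t)) (h *: at_height u 0)
                                 - F (at_height x t)))
       = (fun h : R => h^-1 *: (((fun z => F (at_height z t)) \o shift x) (h *: u)
                                 - F (at_height x t))).
  by apply/funext => h /=; rewrite at_heightZ at_heightD mulr0 add0r.
by rewrite /derive E.
Qed.

End Derivatives.

Lemma derive_height v y : 'D_v height y = height v.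
Proof.
by rewrite derive_entry ?derive_id//.
Qed.

Lemma Ck_height j (U : set 'rV[R]_(k + 1)) : open U -> Ck j U height.
Proof. by move=> oU; apply: Ck_entry => //; exact: Ck_id. Qed.

Lemma Ck_lsubmx j (U : set 'rV[R]_(k + 1)) : open U ->
  Ck j U (lsubmx : 'rV[R]_(k + 1) -> 'rV[R]_k).
Proof.
move=> oU; apply: Ck_row => // i.
have : Ck j U (fun y : 'rV[R]_(k + 1) => y 0 (lshift 1 i)).
  by apply: Ck_entry => //; exact: Ck_id.
by apply: eq_Ck => // y _; rewrite mxE.
Qed.

Lemma Ck_at_height j (V : normedModType R) (U : set V) (f : V -> 'rV[R]_k) (h : V -> R) :
  open U -> Ck j U f -> Ck j U h -> Ck j U (fun p => at_height (f p) (h p)).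
Proof.
move=> oU Cf Ch; apply: Ck_row => // i; case: (split_ordP i) => i' ->.
  have : Ck j U (fun p => f p 0 i') by exact: Ck_entry.
  by apply: eq_Ck => // x _; rewrite row_mxEl.
by apply: eq_Ck Ch => // x _; rewrite row_mxEr mxE.
Qed.

Lemma derive_at_height (V : normedModType R) (f : V -> 'rV[R]_k) (h : V -> R) (p w : V) :
  differentiable f p -> differentiable h p ->
  'D_w (fun p => at_height (f p) (h p)) p = at_height ('D_w f p) ('D_w h p).
Proof.
move=> df dh.
have der : derivable (fun p => at_height (f p) (h p)) p w.
  apply/derivable_mxP => i0 i; rewrite ord1; case: (split_ordP i) => i' ->.
    under eq_fun do rewrite row_mxEl.
    by apply/diff_derivable; exact: differentiable_entry.
  under eq_fun do rewrite row_mxEr mxE.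
  exact/diff_derivable.
rewrite derive_mx//; apply/rowP => i; rewrite mxE; case: (split_ordP i) => i' ->.
  by rewrite row_mxEl -derive_entry//; congr ('D_w _ p); apply/funext => z; rewrite row_mxEl.
by rewrite row_mxEr mxE; congr ('D_w _ p); apply/funext => z; rewrite row_mxEr mxE.
Qed.

End LastCoordinate.

(** * Position of the disc with respect to the origin and the sphere *)

Section Nonvanishing.
Context {R : realType}.

(** Otherwise all derivatives of f would vanish at x, by radius_singular, against
injectivity of the differential; the dimension is positive so that there is a
nonzero direction. *)
Lemma ball_embedding_neq0 k n (f : 'rV[R]_k.+1 -> 'rV[R]_n) (U : set 'rV[R]_k.+1) x :
    ball_embedding f -> Ck 1 U f -> Ck 1 U (fun x => radius (f x)) -> U x -> uball x ->
  f x != 0.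
Proof.
move=> [_ _ imm] [df _] [dr _] Ux bx; apply/eqP => fx0.
have D0 := radius_singular (const_mx 1) (df x Ux) (dr x Ux) fx0.
have /rowP/(_ ord0)/eqP := imm x _ bx D0.
by rewrite !mxE oner_eq0.
Qed.

End Nonvanishing.

Section QuotientPositive.
Context {R : realType} {k n : nat}.
Variables (f : 'rV[R]_k -> 'rV[R]_n) (U : set 'rV[R]_k) (q : 'rV[R]_k -> R).
Hypotheses (oU : open U) (ballU : @uball R k `<=` U).
Hypotheses (Cf : forall j, Ck j U f) (Cq : forall j, Ck j U q).
Hypothesis pq : forall x, U x ->
  1 - dotp (f x) (f x) = (1 - dotp x x) * q x.
Hypothesis fball : proper_ball_embedding f.

Lemma proper_interior x : dotp x x < 1 -> dotp (f x) (f x) < 1.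
Proof.
move=> x1; have [_ fb fs _] := fball.
have bx : uball x by apply/uballE; rewrite ltW.
have /uballE := fb x bx; rewrite le_eqVlt => /orP[/eqP/usphereE/(fs x bx)/usphereE E|//].
by rewrite E ltxx in x1.
Qed.

Lemma quotient_interior x : dotp x x < 1 -> 0 < q x.
Proof.
move=> x1; have bx : uball x by apply/uballE; rewrite ltW.
have : 0 < 1 - dotp (f x) (f x) by rewrite subr_gt0 proper_interior.
by rewrite (pq (ballU bx)) pmulr_rgt0// subr_gt0.
Qed.

(** Differentiating 1 - |f|^2 = (1 - |x|^2) q at a point of the sphere shows that
a zero of q would be a point where all derivatives of |f|^2 vanish, that is,
where f is tangent to the sphere. *)
Lemma quotient_sphere_neq0 x : usphere x -> q x != 0.
Proof.
move=> x1; have [_ _ _ ft] := fball.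
have bx : uball x by apply/uballE; move/usphereE: x1 => ->.
have Ux := ballU bx.
have [df _] := Cf 1; have [dq _] := Cq 1.
have [v] := ft x x1; apply: contra => /eqP q0.
have dff : differentiable (fun y => dotp (f y) (f y)) x.
  have [+ _] : Ck 1 U (fun y => dotp (f y) (f y)) by apply: Ck_dotp.
  exact.
have dw : differentiable (fun y : 'rV[R]_k => dotp y y) x.
  have [+ _] : Ck 1 U (fun y : 'rV[R]_k => dotp y y).
    by apply: Ck_dotp => //; exact: Ck_id.
  exact.
have dC (F : 'rV[R]_k -> R) : differentiable F x ->
    derivable (cst 1 - F) x v /\ 'D_v (cst 1 - F) x = - 'D_v F x.
  move=> dF; have dFv : derivable F x v by exact: diff_derivable.
  split; first by apply: derivableB => //; exact: derivable_cst.
  by rewrite deriveB ?derive_cst ?sub0r//; exact: derivable_cst.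
have [_ E1] := dC _ dff.
have [dw' E2] := dC _ dw.
have : 'D_v (cst 1 - (fun y => dotp (f y) (f y))) x =
       'D_v ((cst 1 - (fun y : 'rV[R]_k => dotp y y)) * q) x.
  apply: near_eq_derive.
  have : nbhs x U by exact: open_nbhs_nbhs.
  by apply: filterS => y Uy; exact: pq.
rewrite deriveM//; last exact/diff_derivable/dq.
rewrite E1 q0 scale0r addr0.
rewrite (_ : (cst 1 - (fun y : 'rV[R]_k => dotp y y)) x = 0); last first.
  by move/usphereE: x1 => x1; rewrite -[LHS]/(1 - dotp x x) x1 subrr.
rewrite scale0r => /eqP; rewrite oppr_eq0 derive_dotp; try exact: df.
by rewrite [dotp (f x) _]dotpC -mulr2n mulrn_eq0.
Qed.

(** On the sphere q is a limit of its positive values along the radius. *)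
Lemma quotient_gt0 x : uball x -> 0 < q x.
Proof.
move=> bx; have := (uballE x).1 bx; rewrite le_eqVlt => /orP[/eqP x1|]; last first.
  exact: quotient_interior.
have sx : usphere x by apply/usphereE.
rewrite lt_def quotient_sphere_neq0//= leNgt; apply/negP => qx.
have cq : {for x, continuous q} by exact: (Ck_continuous (Cq 0) (ballU bx)).
have Nq : \forall y \near x, q y < 0.
  have N0 : nbhs (q x) [set t | t < 0].
    by apply: open_nbhs_nbhs; split => //; exact: open_lt.
  exact: cq _ N0.
have cs : {for 0, continuous (fun s : R => x + s *: x)}.
  apply: differentiable_continuous.
  by apply: differentiableD => //; exact: differentiableZl.
have Ns : \forall s \near (0 : R)^'-, q (x + s *: x) < 0.
  apply: cvg_within.
  by have := cs [set y | q y < 0]; rewrite /= scale0r addr0; exact.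
have : \forall s \near (0 : R)^'-, False.
  near=> s.
  have s0 : s < 0 by [].
  have s1 : -1 < s by near: s; exact: nbhs_left_gt.
  have : q (x + s *: x) < 0 by near: s.
  apply/negP; rewrite -leNgt ltW// quotient_interior//.
  rewrite -[x in x + _]scale1r -scalerDl dotpZl dotpC dotpZl x1 mulr1 -expr2.
  by rewrite expr_lt1//; lra.
by move/filter_ex => -[].
Unshelve. all: by end_near. Qed.

End QuotientPositive.

(** * The thickened disc bounded by the double *)

Section Double.
Context {R : realType} {k n : nat}.
Variables (f : 'rV[R]_k -> 'rV[R]_n) (q : 'rV[R]_k -> R).

(** On the unit sphere |x|^2 + t^2 = 1 the factor sqrt (q x) turns the height t
into a square root of 1 - |f x|^2, so the two hemispheres go to the two copies
of the disc. *)
Definition doubled (y : 'rV[R]_(k + 1)) : 'rV[R]_(n + 1) :=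
  at_height (f (lsubmx y)) (height y * Num.sqrt (q (lsubmx y))).

Lemma doubled_at_height x t : doubled (at_height x t) = at_height (f x) (t * Num.sqrt (q x)).
Proof. by rewrite /doubled lsubmx_at_height height_at_height. Qed.

Lemma doubled_at_height0 x : doubled (at_height x 0) = at_height (f x) 0.
Proof. by rewrite doubled_at_height mul0r. Qed.

Lemma dotp_decomp (y : 'rV[R]_(k + 1)) :
  dotp y y = dotp (lsubmx y) (lsubmx y) + height y ^+ 2.
Proof. by rewrite -{1 2}[y]at_heightK dotp_at_height expr2. Qed.

Lemma uball_lsubmx (y : 'rV[R]_(k + 1)) : uball y -> uball (lsubmx y : 'rV[R]_k).
Proof.
move=> /uballE; rewrite dotp_decomp => y1; apply/uballE; apply: le_trans y1.
by rewrite lerDl sqr_ge0.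
Qed.

Variable U : set 'rV[R]_k.
Hypotheses (oU : open U) (ballU : @uball R k `<=` U).
Hypotheses (Cf : forall j, Ck j U f) (Cq : forall j, Ck j U q).
Hypothesis pq : forall x, U x ->
  1 - dotp (f x) (f x) = (1 - dotp x x) * q x.
Hypothesis fball : proper_ball_embedding f.
Hypothesis fneq0 : forall x, uball x -> f x != 0.

Definition doubled_domain : set 'rV[R]_(k + 1) :=
  [set y | U (lsubmx y) /\ 0 < q (lsubmx y)].

Lemma open_doubled_domain : open doubled_domain.
Proof.
pose U' : set 'rV[R]_k := [set x | U x /\ 0 < q x].
have oU' : open U'.
  by apply: (open_preimage oU _ open_gt0) => x; exact: (Ck_continuous (Cq 0)).
have C : Ck 0 setT (lsubmx : 'rV[R]_(k + 1) -> 'rV[R]_k).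
  by apply: Ck_lsubmx; exact: openT.
have := open_preimage openT (fun x => Ck_continuous C) oU'.
by congr open; apply/seteqP; split => [y []//|y].
Qed.

Let oG := open_doubled_domain.

Lemma uball_doubled_domain : @uball R (k + 1) `<=` doubled_domain.
Proof.
move=> y /uball_lsubmx by'; split; first exact: ballU.
exact: (quotient_gt0 oU ballU Cf Cq pq fball).
Qed.

Let base_U y : doubled_domain y -> U (lsubmx y). Proof. by case. Qed.

Lemma Ck_base j (F : 'rV[R]_k -> R) : Ck j U F ->
  Ck j doubled_domain (fun y => F (lsubmx y)).
Proof.
by move=> CF; exact: (Ck_comp_row oG base_U (Ck_lsubmx j oG) CF).
Qed.

Lemma Ck_doubled j : Ck j doubled_domain doubled.
Proof.
apply: Ck_at_height => //.
  apply: Ck_row => // i.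
  by apply: (@Ck_base j (fun x => f x 0 i)); exact: Ck_entry.
apply: CkM => //; first exact: Ck_height.
apply: Ck_sqrt_comp => // [y []//|]; exact: Ck_base.
Qed.

Lemma differentiable_doubled y : doubled_domain y -> differentiable doubled y.
Proof. by have [+ _] := Ck_doubled 1; apply. Qed.

Lemma dotp_doubled_sum y : doubled_domain y ->
  dotp (doubled y) (doubled y) =
    dotp (f (lsubmx y)) (f (lsubmx y)) + height y ^+ 2 * q (lsubmx y).
Proof.
by move=> [_ q0]; rewrite dotp_at_height -expr2 exprMn sqr_sqrtr// ltW.
Qed.

(** The identity behind the whole construction: balls go to balls and spheres to
spheres because q is positive. *)
Lemma dotp_doubled y : doubled_domain y ->
  dotp (doubled y) (doubled y) = 1 - q (lsubmx y) * (1 - dotp y y).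
Proof.
move=> Gy; rewrite dotp_doubled_sum// dotp_decomp.
have := pq (base_U Gy); set a := dotp (f _) _; set b := dotp _ _; lra.
Qed.

Lemma derive_doubled y v : doubled_domain y ->
  'D_v doubled y = at_height ('D_(lsubmx v) f (lsubmx y))
    (height v * Num.sqrt (q (lsubmx y)) +
     height y * 'D_(lsubmx v) (fun x => Num.sqrt (q x)) (lsubmx y)).
Proof.
move=> Gy; have [df _] := Cf 1.
have Cs : Ck 1 doubled_domain (fun y => Num.sqrt (q (lsubmx y))).
  by apply: Ck_sqrt_comp => // [z []//|]; exact: Ck_base.
have ds : differentiable (fun y => Num.sqrt (q (lsubmx y))) y.
  by have [+ _] := Cs; exact.
have dh : differentiable (@height R k) y.
  by have [+ _] := @Ck_height R k 1 _ oG; exact.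
have dfl : differentiable (fun y : 'rV[R]_(k + 1) => f (lsubmx y)) y.
  have : Ck 1 doubled_domain (fun y : 'rV[R]_(k + 1) => f (lsubmx y)).
    apply: Ck_row => // i.
    by apply: (@Ck_base 1 (fun x => f x 0 i)); exact: Ck_entry.
  by case=> + _; exact.
have dm : differentiable (@height R k * (fun y => Num.sqrt (q (lsubmx y)))) y.
  exact: differentiableM.
rewrite [LHS](derive_at_height v dfl dm) derive_lsubmx; congr at_height.
rewrite deriveM; try exact: diff_derivable.
rewrite derive_height (derive_lsubmx (fun x => Num.sqrt (q x))) addrC.
by congr (_ + _); exact: mulrC.
Qed.

Lemma derive_doubled_up y : doubled_domain y ->
  'D_(@up R k) doubled y = at_height 0 (Num.sqrt (q (lsubmx y))).
Proof.
move=> Gy; rewrite derive_doubled// /up lsubmx_at_height height_at_height.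
by rewrite !derive0 mulr0 addr0 mul1r.
Qed.

Lemma doubled_injective : {in @uball R (k + 1) &, injective doubled}.
Proof.
move=> y z /set_mem by' /set_mem bz E.
have [[_ injf _] _ _ _] := fball.
have E1 : lsubmx y = lsubmx z.
  apply: injf; try exact/mem_set/uball_lsubmx.
  by rewrite -[LHS](lsubmx_at_height _ (height y * Num.sqrt (q (lsubmx y)))) -/(doubled y) E
     lsubmx_at_height.
have [_ qz] := uball_doubled_domain bz.
rewrite -[y]at_heightK -[z]at_heightK E1; congr at_height.
have : height (doubled y) = height (doubled z) by rewrite E.
by rewrite !height_at_height E1 => /mulIf; apply; rewrite gt_eqF// sqrtr_gt0.
Qed.

Lemma doubled_immersion y v : uball y -> 'D_v doubled y = 0 -> v = 0.
Proof.
move=> by'; have [[_ _ immf] _ _ _] := fball.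
have Gy := uball_doubled_domain by'; have [_ q0] := Gy.
rewrite derive_doubled// => /at_height_eq0[/(immf _ _ (uball_lsubmx by')) v0].
rewrite v0 derive0 mulr0 addr0 => /eqP; rewrite mulf_eq0 => /orP[/eqP h0|].
  rewrite -[v]at_heightK v0 h0 /at_height.
  by apply/rowP => i; case: (split_ordP i) => i' ->; rewrite ?row_mxEl ?row_mxEr !mxE.
by rewrite gt_eqF// sqrtr_gt0.
Qed.

Lemma doubled_smooth_ball : smooth_on (@uball R (k + 1)) doubled.
Proof.
exists doubled_domain; split => // [|j]; [exact: uball_doubled_domain|exact: Ck_doubled].
Qed.

Lemma doubled_embedding : ball_embedding doubled.
Proof.
split; [exact: doubled_smooth_ball|exact: doubled_injective|exact: doubled_immersion].
Qed.

Lemma doubled_sphere y : uball y -> (usphere (doubled y) <-> usphere y).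
Proof.
move=> by'; have Gy := uball_doubled_domain by'; have [_ q0] := Gy.
split => /usphereE => [|y1]; last first.
  by apply/usphereE; rewrite dotp_doubled// y1 subrr mulr0 subr0.
rewrite dotp_doubled// => E; apply/usphereE.
have /eqP : q (lsubmx y) * (1 - dotp y y) = 0 by lra.
by rewrite mulf_eq0 gt_eqF//= subr_eq0 eq_sym => /eqP.
Qed.

Lemma doubled_ball y : uball y -> uball (doubled y).
Proof.
move=> by'; have Gy := uball_doubled_domain by'; have [_ q0] := Gy.
apply/uballE; rewrite dotp_doubled// gerBl mulr_ge0 ?(ltW q0)// subr_ge0.
exact/uballE.
Qed.

(** By dotp_doubled the squared radius has derivative 2 q |y|^2 in the direction y. *)
Lemma doubled_transversal y : usphere y -> dotp ('D_y doubled y) (doubled y) != 0.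
Proof.
move=> y1; have /usphereE E := y1.
have by' : uball y by apply/uballE; rewrite E.
have Gy := uball_doubled_domain by'; have [_ q0] := Gy.
have dD := differentiable_doubled Gy.
have dqb : differentiable (fun z : 'rV[R]_(k + 1) => q (lsubmx z)) y.
  by have [+ _] := Ck_base (Cq 1); exact.
have dw : differentiable (fun z : 'rV[R]_(k + 1) => dotp z z) y.
  have [+ _] : Ck 1 doubled_domain (fun y : 'rV[R]_(k + 1) => dotp y y).
    by apply: Ck_dotp => //; exact: Ck_id.
  exact.
have dw1 : differentiable ((fun z : 'rV[R]_(k + 1) => dotp z z) - cst 1) y.
  by apply: differentiableB => //; exact: differentiable_cst.
have : 'D_y (fun z => dotp (doubled z) (doubled z)) y =
       'D_y (cst 1 + (fun z : 'rV[R]_(k + 1) => q (lsubmx z)) *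
                  ((fun z : 'rV[R]_(k + 1) => dotp z z) - cst 1)) y.
  apply: near_eq_derive.
  have : nbhs y doubled_domain by exact: open_nbhs_nbhs.
  apply: filterS => z Gz; rewrite dotp_doubled//.
  by rewrite -[RHS]/(1 + q (lsubmx z) * (dotp z z - 1)) -mulrN opprB.
rewrite deriveD; [|exact: derivable_cst|exact/diff_derivable/differentiableM].
rewrite derive_cst add0r deriveM; try exact: diff_derivable.
rewrite deriveB; [|exact: diff_derivable|exact: derivable_cst].
rewrite derive_cst subr0 !derive_dotp// derive_id.
rewrite (_ : ((fun z : 'rV[R]_(k + 1) => dotp z z) - cst 1) y = 0); last first.
  by rewrite -[LHS]/(dotp y y - 1) E subrr.
rewrite scale0r addr0 E [dotp (doubled y) _]dotpC => E2.
apply/eqP => E3; move: E2; rewrite E3 addr0 => /esym/eqP.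
by rewrite mulf_eq0 gt_eqF//= => /eqP; lra.
Qed.

Lemma doubled_proper : proper_ball_embedding doubled.
Proof.
split; [exact: doubled_embedding|exact: doubled_ball|exact: doubled_sphere|].
by move=> y y1; exists y; exact: doubled_transversal.
Qed.

Notation rho := (fun y => radius (doubled y)).

Definition radius_domain : set 'rV[R]_(k + 1) :=
  [set y | doubled_domain y /\ 0 < dotp (doubled y) (doubled y)].

Lemma open_radius_domain : open radius_domain.
Proof.
apply: (open_preimage oG _ open_gt0) => y; apply: (@Ck_continuous _ _ _ 0).
by apply: Ck_dotp => //; exact: Ck_doubled.
Qed.

Let oD := open_radius_domain.

Lemma uball_radius_domain : @uball R (k + 1) `<=` radius_domain.
Proof.
move=> y by'; have Gy := uball_doubled_domain by'; split => //; have [_ q0] := Gy.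
rewrite dotp_doubled_sum//; apply: ltr_wpDr.
  by rewrite mulr_ge0 ?sqr_ge0// ltW.
by rewrite lt_def dotp_ge0 dotp_eq0 andbT; exact/fneq0/uball_lsubmx.
Qed.

Lemma Ck_radius_doubled j : Ck j radius_domain rho.
Proof.
apply: Ck_sqrt_comp => // [y []//|].
apply: Ck_subset (Ck_dotp oG (Ck_doubled j) (Ck_doubled j)).
by move=> y [].
Qed.

Let radius_pos y : radius_domain y -> 0 < rho y.
Proof. by move=> [_ d0]; rewrite sqrtr_gt0. Qed.

(** The derivative vanishes only at height 0: this is what confines the critical
points to the original disc. *)
Lemma derive_radius_up y : radius_domain y ->
  'D_(@up R k) rho y = height y * (q (lsubmx y) / rho y).
Proof.
move=> Dy; have [Gy _] := Dy; have [_ q0] := Gy; have r0 := radius_pos Dy.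
have [dr _] := Ck_radius_doubled 1.
have := derive_radius (@up R k) (differentiable_doubled Gy) (dr y Dy).
rewrite derive_doubled_up//.
rewrite dotp_at_height -[X in dotp X _](scale0r (0 : 'rV[R]_n)) dotpZl mul0r add0r.
rewrite mulrCA -expr2 sqr_sqrtr ?(ltW q0)// => E.
by rewrite mulrA -E mulrAC divff ?mul1r// gt_eqF.
Qed.

Let radius_slice x : radius (doubled (at_height x 0)) = radius (f x).
Proof. by rewrite doubled_at_height0 /Defs.radius dotp_at_height mul0r addr0. Qed.

Lemma critical_doubled y : uball y -> critical_point rho y ->
  height y = 0 /\ critical_point (fun x => radius (f x)) (lsubmx y).
Proof.
move=> by' cy; have Dy := uball_radius_domain by'; have r0 := radius_pos Dy.
have [[_ q0] _] := Dy.
have h0 : height y = 0.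
  have := cy (@up R k); rewrite derive_radius_up// => /eqP.
  by rewrite mulf_eq0 => /orP[/eqP//|]; rewrite gt_eqF// divr_gt0.
split => // u; rewrite -[RHS](cy (at_height u 0)) -[y in RHS]at_heightK h0.
rewrite [RHS]derive_slice.
have -> : (fun z => rho (at_height z 0)) = (fun x => radius (f x)) by exact/funext.
by [].
Qed.

Let radius_even x t :
  radius (doubled (at_height x (- t))) = radius (doubled (at_height x t)).
Proof.
by rewrite !doubled_at_height /Defs.radius !dotp_at_height mulNr mulrNN.
Qed.

Let slice_near x : radius_domain (at_height x 0) ->
  \forall z \near x, radius_domain (at_height z 0).
Proof.
move=> Dx.
have C : Ck 0 setT (fun z : 'rV[R]_k => at_height z 0).
  by apply: Ck_at_height; [exact: openT|exact: Ck_id|exact: Ck_cst].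
have cx : {for x, continuous (fun z : 'rV[R]_k => at_height z 0)} by exact: C.
by apply: cx; exact: open_nbhs_nbhs.
Qed.

(** An even function has derivative 0 at 0. The radius of the thickening is even in
the height, which kills the mixed second derivatives. *)
Lemma derive_up_even (F : 'rV[R]_(k + 1) -> R) x :
    (forall t, F (at_height x (- t)) = F (at_height x t)) ->
    differentiable F (at_height x 0) ->
  'D_(@up R k) F (at_height x 0) = 0.
Proof.
move=> Fe dF.
have E : 'D_(- @up R k) F (at_height x 0) = 'D_(@up R k) F (at_height x 0).
  have E : (fun h : R => h^-1 *: ((F \o shift (at_height x 0)) (h *: - @up R k)
                                   - F (at_height x 0)))
         = (fun h : R => h^-1 *: ((F \o shift (at_height x 0)) (h *: @up R k)
                                   - F (at_height x 0))).
    apply/funext => h /=; congr (_ *: (_ - _)).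
    have up_line t : t *: @up R k + at_height x 0 = at_height x t.
      by rewrite /up at_heightZ at_heightD scaler0 add0r mulr1 addr0.
    by rewrite scalerN -scaleNr !up_line.
  by rewrite /derive E.
move: E; rewrite !deriveE// linearN => E; lra.
Qed.

(** At height 0 the horizontal block is the Hessian of the radius of f, because the
slice at height 0 is f itself. Since the vertical derivative is the height times
q / radius, its own vertical derivative at height 0 is q / radius, and it
vanishes identically along the slice. *)
Lemma hessian_doubled x : radius_domain (at_height x 0) ->
  hessian rho (at_height x 0) =
    stabilized (hessian (fun x => radius (f x)) x) (q x / radius (f x)).
Proof.
move=> Dx; have [dr Cdr] := Ck_radius_doubled 2.
have dDr v : differentiable ('D_v rho) (at_height x 0).
  by have [+ _] := Cdr v; apply.
have slice i : (fun z => 'D_(base_direction i) rho (at_height z 0)) =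
    'D_(delta_mx 0 i) (fun x => radius (f x)).
  have E : (fun z => rho (at_height z 0)) = (fun x => radius (f x)).
    by apply/funext => z; exact: radius_slice.
  by apply/funext => z; rewrite /base_direction [LHS]derive_slice E.
rewrite -[LHS]submxK /stabilized; congr block_mx; apply/matrixP => i j; rewrite !mxE.
- by rewrite !delta_lshift derive_slice slice.
- rewrite delta_lshift delta_rshift derive_slice.
  rewrite (near_eq_derive (g := cst 0)) ?derive_cst//.
  apply: filterS (slice_near Dx) => z Dz.
  by rewrite derive_radius_up// height_at_height mul0r.
- rewrite delta_lshift delta_rshift.
  apply: (@derive_up_even ('D_(base_direction j) rho) x); last exact: dDr.
  move=> t; have E : (fun z => rho (at_height z (- t))) = (fun z => rho (at_height z t)).
    by apply/funext => z; exact: radius_even.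
  by rewrite /base_direction [LHS]derive_slice [RHS]derive_slice E.
- rewrite !ord1 !delta_rshift eqxx mulr1n.
  have dq : differentiable (fun y => q (lsubmx y) * (rho y)^-1) (at_height x 0).
    have [+ _] : Ck 1 radius_domain (fun y => q (lsubmx y) * (rho y)^-1).
      apply: CkM => //.
        by apply: Ck_subset (Ck_base (Cq 1)) => z [].
      apply: Ck_inv_comp => // [z Dz|]; first by rewrite gt_eqF// radius_pos.
      exact: Ck_radius_doubled.
    exact.
  have dh : differentiable (@height R k) (at_height x 0).
    by have [+ _] := @Ck_height R k 1 _ oG; apply; case: Dx.
  rewrite (near_eq_derive (g := @height R k * (fun y => q (lsubmx y) * (rho y)^-1))).
    rewrite deriveM; try exact: diff_derivable.
    rewrite derive_height !height_at_height scale0r add0r.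
    by rewrite radius_slice lsubmx_at_height [LHS]mulr1.
  have : nbhs (at_height x 0) radius_domain by exact: open_nbhs_nbhs.
  by apply: filterS => z Dz; rewrite derive_radius_up.
Qed.

Hypothesis fmorse : morse_on (@uball R k) (fun x => radius (f x)).
Hypothesis findex : forall x, uball x -> critical_point (fun x => radius (f x)) x ->
  ~ has_index (hessian (fun x => radius (f x)) x) 2.

Let critical_hessian y : uball y -> critical_point rho y ->
  let x := lsubmx y in [/\ uball x, critical_point (fun x => radius (f x)) x,
    0 < q x / radius (f x) &
    hessian rho y = stabilized (hessian (fun x => radius (f x)) x) (q x / radius (f x))].
Proof.
move=> by' cy x; have [h0 cx] := critical_doubled by' cy.
have yE : y = at_height x 0 by rewrite -h0 at_heightK.
have Dy := uball_radius_domain by'.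
split => //; first exact: uball_lsubmx.
  have [[_ q0] _] := Dy; apply: divr_gt0 => //.
  by have := radius_pos Dy; rewrite yE radius_slice.
by rewrite yE in Dy *; exact: hessian_doubled.
Qed.

Lemma doubled_ribbon : ribbon_ball doubled.
Proof.
have [_ funit] := fmorse.
split; first exact: doubled_proper.
  split; first by exists radius_domain; split => // [|j];
    [exact: uball_radius_domain|exact: Ck_radius_doubled].
  move=> y by' cy; have [bx cx c0 ->] := critical_hessian by' cy.
  by apply: stabilized_unit; [rewrite gt_eqF|exact: funit].
move=> y by' cy; have [bx cx c0 ->] := critical_hessian by' cy.
by move=> /(stabilized_index c0); exact: findex.
Qed.

End Double.

(** * The equator and the double *)

Section Assembly.
Context {R : realType}.

Lemma usphere_uball n (x : 'rV[R]_n) : usphere x -> uball x.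
Proof. by move=> /usphereE x1; apply/uballE; rewrite x1. Qed.

Lemma ball_embedding_sphere k n (g : 'rV[R]_k -> 'rV[R]_n) :
  ball_embedding g -> sphere_embedding g.
Proof.
move=> [[U [oU bU CU]] inj imm]; split.
- by exists U; split => // x /usphere_uball/bU.
- by move=> x y /set_mem/usphere_uball/mem_set xb /set_mem/usphere_uball/mem_set yb; exact: inj.
- by move=> x v /usphere_uball xb _; exact: imm.
Qed.

Lemma ambient_isotopic_refl n (A : set 'rV[R]_n) : ambient_isotopic A A.
Proof.
exists (fun _ x => x); split => //; last exact: image_id.
  exists setT; split => // [|j]; [exact: openT|exact: Ck_snd].
move=> t _; split; last exact: image_id.
split => //; first by exists setT; split => // [|j]; [exact: openT|exact: Ck_id].
by move=> x v _ _; rewrite derive_id.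
Qed.

(** Here q comes from sphere_division, on the common domain of smoothness of f and
of its radius. The last clause is what remains of the explicit form of the
double for transversality to the equator. *)
Lemma ribbon_ball_doubled k n (f : 'rV[R]_k.+1 -> 'rV[R]_n) : ribbon_ball f ->
  exists q : 'rV[R]_k.+1 -> R,
    [/\ forall x, uball x -> 0 < q x,
        ribbon_ball (doubled f q) &
        forall y, uball y ->
          'D_(@up R k.+1) (doubled f q) y = at_height 0 (Num.sqrt (q (lsubmx y)))].
Proof.
move=> [fp fm fi].
have [fe fb fs ft] := fp.
have [[U1 [oU1 bU1 CU1]] _ _] := fe.
have [[U2 [oU2 bU2 CU2]] _] := fm.
pose U := U1 `&` U2.
have oU : open U by exact: openI.
have bU : @uball R k.+1 `<=` U by move=> x bx; split; [exact: bU1|exact: bU2].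
have Cf j : Ck j U f by apply: Ck_subset (CU1 j) => x [].
have Cr j : Ck j U (fun x => Defs.radius (f x)) by apply: Ck_subset (CU2 j) => x [].
have [|x Ux x1|q [Cq pq]] := @sphere_division R k.+1 U (fun x => 1 - dotp (f x) (f x)) oU.
- move=> j; have : Ck j U (fun x => 1 + -1 * dotp (f x) (f x)).
    apply: CkD => //; first exact: Ck_cst.
    by apply: CkM => //; [exact: Ck_cst|exact: Ck_dotp].
  by apply: eq_Ck => // x _; rewrite mulN1r.
- have /usphereE -> : usphere (f x) by apply/(fs x (usphere_uball x1)).
  by rewrite subrr.
have fn0 x : uball x -> f x != 0.
  by move=> bx; exact: (ball_embedding_neq0 fe (Cf 1) (Cr 1) (bU x bx)).
exists q; split.
- exact: (quotient_gt0 oU bU Cf Cq pq fp).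
- exact: (doubled_ribbon oU bU Cf Cq pq fp fn0).
- move=> y /(uball_doubled_domain oU bU Cf Cq pq fp); exact: derive_doubled_up.
Qed.

Definition equator n : 'M[R]_(n, n + 1) := row_mx 1%:M 0.

Lemma mul_equator n (x : 'rV[R]_n) : x *m equator n = at_height x 0.
Proof.
by rewrite mul_mx_row mulmx1 mulmx0; congr row_mx; apply/rowP => j; rewrite !mxE.
Qed.

Lemma equator_isometry n : equator n *m (equator n)^T = 1%:M.
Proof. by rewrite tr_row_mx mul_row_col trmx1 mulmx1 trmx0 mulmx0 addr0. Qed.

Section Equator.
Context {k n : nat}.
Variables (f : 'rV[R]_k -> 'rV[R]_n) (q : 'rV[R]_k -> R).
Hypothesis q_gt0 : forall x, uball x -> 0 < q x.

Let height_doubled0 y : uball y -> height (doubled f q y) = 0 -> height y = 0.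
Proof.
move=> /uball_lsubmx/q_gt0 q0; rewrite height_at_height => /eqP.
by rewrite mulf_eq0 [_ (q _) == 0]gt_eqF ?sqrtr_gt0// orbF => /eqP.
Qed.

(** A point of the double lies on the equator when t * sqrt (q x) = 0, that is,
when t = 0 and so |x| = 1. *)
Lemma equator_doubled : (forall x, uball x -> usphere x -> usphere (f x)) ->
  (mulmxr (equator n) @` @usphere R n) `&` (doubled f q @` @usphere R (k + 1)) =
  mulmxr (equator n) @` (f @` @usphere R k).
Proof.
move=> fs; apply/seteqP; split => [z [[x x1 <-{z}] [y y1]]|_ [_ [x x1 <-] <-]].
  rewrite /= mul_equator => E.
  have h0 : height y = 0.
    by apply: height_doubled0; [exact: usphere_uball|rewrite E height_at_height].
  exists x; last by rewrite /= mul_equator.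
  exists (lsubmx y); last first.
    by rewrite -(lsubmx_at_height x 0) -E lsubmx_at_height.
  by apply/usphereE; move/usphereE: y1; rewrite dotp_decomp h0 expr0n addr0.
have bx := usphere_uball x1.
split; first by exists (f x) => //; exact: fs.
exists (at_height x 0); last by rewrite doubled_at_height0 /= mul_equator.
by apply/usphereE; rewrite dotp_at_height mulr0 addr0; exact/usphereE.
Qed.

(** At a point of the equatorial circle the vertical direction is tangent to the
sphere and its image is vertical, with length sqrt (q x) > 0. *)
Lemma doubled_equator_transverse y :
    'D_(@up R k) (doubled f q) y = at_height 0 (Num.sqrt (q (lsubmx y))) ->
    usphere y -> (mulmxr (equator n) @` @usphere R n) (doubled f q y) ->
  exists2 v, dotp y v = 0 & ~~ ('D_v (doubled f q) y <= equator n)%MS.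
Proof.
move=> dD y1 [x x1]; rewrite /= mul_equator => E.
have h0 : height y = 0.
  by apply: height_doubled0; [exact: usphere_uball|rewrite -E height_at_height].
exists (@up R k).
  rewrite -[y]at_heightK h0 dotp_at_height mul0r addr0 dotpC.
  by rewrite -[X in dotp X _](scale0r (0 : 'rV[R]_k)) dotpZl mul0r.
apply/negP => /submxP[B]; rewrite mul_equator dD => /(congr1 (@height R n)).
rewrite !height_at_height => /eqP.
by rewrite gt_eqF// sqrtr_gt0; exact/q_gt0/uball_lsubmx/usphere_uball.
Qed.

End Equator.

End Assembly.

Theorem proposition6 (R : realType) (K : set 'rV[R]_4) :
  ribbon_1knot K -> half_ribbon K.
Proof.
move=> [knotK [f [ribf fK]]]; split => //.
have [q [q0 ribD dD]] := ribbon_ball_doubled ribf.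
have [[embD ballD sphereD _] _ _] := ribD.
have embS := ball_embedding_sphere embD.
have [[_ _ fs _] _ _] := ribf.
exists (doubled f q @` @usphere R 3).
  split.
    split; last by exists (doubled f q).
    by move=> _ [y y1 <-]; apply/(sphereD y (usphere_uball y1)).
  exists (doubled f q @` @usphere R 3); first exact: ambient_isotopic_refl.
  by exists (doubled f q).
exists (doubled f q @` @usphere R 3); first exact: ambient_isotopic_refl.
exists (equator 4), (doubled f q); split => //.
- exact: equator_isometry.
- have sf x : uball x -> usphere x -> usphere (f x) by move=> bx /(fs x bx).
  by rewrite -fK; exact: (equator_doubled q0 sf).
- move=> y y1; apply: doubled_equator_transverse => //.
  exact/dD/usphere_uball.
Qed.
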